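(* Let $\Xi=\otimes_{s\in\mathcal S}\Xi_s$ be any nonempty state-wise decomposable set of noise distributions, and let $\mathcal T^{\mathrm{DS},\Xi}$, $V^{\mathrm{DS},\Xi}$ be the Bellman mapping and the value function of the distributional stochastic MDP (DS-MDP) defined in the context. Then: (i) $\mathcal T^{\mathrm{DS},\Xi}$ is monotonically increasing and translation invariant: for any $V,V'\in\mathbb R^{|\mathcal S|}$ with $V\ge V'$ one has $\mathcal T^{\mathrm{DS},\Xi}[V]\ge \mathcal T^{\mathrm{DS},\Xi}[V']$, and $\mathcal T^{\mathrm{DS},\Xi}[V+\alpha \mathbf e]=\mathcal T^{\mathrm{DS},\Xi}[V]+\alpha$, where $\alpha$ is a scalar (on the right-hand side added to every component) and $\mathbf e$ is the unit vector (all components equal to one) of size $|\mathcal S|$. (ii) $\mathcal T^{\mathrm{DS},\Xi}$ is a contraction mapping of parameter $\gamma$ with respect to the infinity norm: for any $V,V'\in\mathbb R^{|\mathcal S|}$, $\|\mathcal T^{\mathrm{DS},\Xi}[V]-\mathcal T^{\mathrm{DS},\Xi}[V']\|_\infty\le\gamma\|V-V'\|_\infty$. (iii) If $\sup_{d_s\in\Xi_s}\mathbb E_{\epsilon_s\sim d_s}[\max_{a}\{r(a|s)+\epsilon(a|s)\}]$ is bounded from above for all $s\in\mathcal S$, then $V^{\mathrm{DS},\Xi}$ is the unique fixed point solution to the system $\mathcal T^{\mathrm{DS},\Xi}[V]=V$. (iv) The densities of the optimal decision rules (i.e. the optimal policy) can be computed as $$\pi^{\mathrm{DS},*}(a|s)=\frac{\partial\varphi_s(w_s)}{\partial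 w_{sa}},\qquad \forall a\in\mathcal A,\ s\in\mathcal S,$$ where $w_s$ is a vector of size $|\mathcal A|$ with entries $w_{sa}=r(a|s)+\gamma\sum_{s'}q(s'|s,a)V^{\mathrm{DS},\Xi}(s')$ and $$\varphi_s(w_s)=\sup_{d_s\in\Xi_s}\Big\{\mathbb E_{\epsilon_s\sim d_s}\big[\max_{a\in\mathcal A}\{w_{sa}+\epsilon(a|s)\}\big]\Big\}.$$
   Context: Setting. $\mathcal S$ is a finite set of states, $\mathcal A$ a finite set of actions, $q(s'|s,a)$ is the probability of moving from state $s$ to $s'$ when action $a$ is performed, $r(a|s)\in\mathbb R$ is the deterministic part of the reward, and $\gamma\in[0,1]$ is the discount factor. Inequalities between vectors are componentwise. DS-MDP. The stochastic reward for action $a$ at state $s$ is $r(a|s)+\epsilon(a|s)$, where $\epsilon_s=(\epsilon(a|s))_{a\in\mathcal A}$ is a random noise vector. The distributions of the noise vectors are continuous and independent over states. The distribution of the noise is not given with certainty but belongs to an ambiguity set $\Xi=\otimes_{s\in\mathcal S}\Xi_s$, where $\Xi_s$ is an ambiguity set for the distributions of $\epsilon_s$. At each time $t=0,1,\dots$ one chooses a distribution $d^t\in\Xi$ of the noise $\epsilon^t$ at time $t$ and a decision rule $\psi^t$, where $\psi^t(s|\epsilon_s)\in\mathcal A$ is the (deterministic) action taken at state $s$ under realization $\epsilon_s$ of the noise. The value function is $$V^{\mathrm{DS},\Xi}(s)=\sup_{d^t\in\Xi,\ t=0,1,\dots}\ \sup_{\psi^0,\psi^1,\dots}\ \mathbb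 E_{\epsilon^t\sim d^t,\ t=0,1,\dots}\Big[\mathbb E_{\tau\sim(\Psi,q)}\Big[\sum_{t=0}^\infty\gamma^t\big(r(a_t|s_t)+\epsilon(a_t|s_t)\big)\,\Big|\,s_0=s\Big]\Big],$$ where $\Psi=(\psi^0,\psi^1,\dots)$, $\tau=(s_0,a_0,s_1,a_1,\dots)$ is the trajectory generated by the decision rules and the transition probabilities, and $\epsilon(a_t|s_t)$ in the $t$-th term is a component of $\epsilon^t$. The Bellman mapping is $$\mathcal T^{\mathrm{DS},\Xi}[V](s)=\sup_{d_s\in\Xi_s}\Big\{\mathbb E_{\epsilon_s\sim d_s}\Big[\max_{a\in\mathcal A}\Big\{r(a|s)+\epsilon(a|s)+\gamma\sum_{s'}q(s'|s,a)V(s')\Big\}\Big]\Big\}.$$ Optimal policy. An optimal decision rule is $\psi^*(s|\epsilon_s)=\mathrm{argmax}_{a\in\mathcal A}\{w_{sa}+\epsilon(a|s)\}$ with $w_{sa}=r(a|s)+\gamma\sum_{s'}q(s'|s,a)V^{\mathrm{DS},\Xi}(s')$. Its density (the optimal policy) is $\pi^{\mathrm{DS},*}(a|s)=\mathbb P_{\epsilon_s\sim d_s(w_s)}[\psi^*(s|\epsilon_s)=a]$, where $d_s(w_s)$ is the distribution (or limit of a sequence of distributions, in case $\Xi_s$ is not compact) attaining the supremum defining $\varphi_s(w_s)$.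
   Formalization: In (i) the shift is γα, not α; (iii) needs γ<1; the max noise is integrable and V^DS ranges over strategies with absolutely integrable total reward; (iv) holds where φ_s, V^DS are finite and the partial derivative exists, existence shown if all maximizing sequences tend to one continuous law. *)

(* Defs.v *)
From HB Require Import structures.
From mathcomp Require Import all_boot all_order all_algebra.
From mathcomp Require Import all_classical all_reals all_analysis.

Set Implicit Arguments.
Unset Strict Implicit.
Unset Printing Implicit Defensive.

Import Order.TTheory GRing.Theory Num.Theory.
Import numFieldNormedType.Exports.

Local Open Scope classical_set_scope.
Local Open Scope ring_scope.

(** Noise vectors (ε(a|s))_{a ∈ A} at one state are elements of R^{|A|}, with the
    product (Borel) σ-algebra of the library; the entry of index [a : A] is
    [noise_at e a]. *)
Definition noise_at (R : realType) (A : finType) (e : #|A|.-tuple R) (a : A) : R :=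
  tnth e (enum_rank a).

Definition noise_law (R : realType) (A : finType) : Type :=
  probability (#|A|.-tuple R) R.

(** n-dimensional Lebesgue measure of a Borel set, by slicing. *)
Fixpoint lebesgue_tuple (R : realType) (n : nat) : set (n.-tuple R) -> \bar R :=
  match n with
  | 0%N => fun B => (\1_B [tuple])%:E
  | m.+1 => fun B =>
      (\int[lebesgue_measure]_(x in [set: R])
          lebesgue_tuple [set v : m.-tuple R | B [tuple of x :: v]])%E
  end.

(** "Continuous distribution": absolutely continuous, i.e. with a density. The
    weaker requirement of a continuous distribution function would allow
    ε(a) = ε(b) almost surely. *)
Definition continuous_law (R : realType) (A : finType) (d : noise_law R A) : Prop :=
  forall B : set (#|A|.-tuple R),
    measurable B -> lebesgue_tuple B = 0%E -> d B = 0%E.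

(** max_{a ∈ A} f a; the value -oo can only occur for empty A. *)
Definition max_over (R : realType) (A : finType) (f : A -> R) : \bar R :=
  (\big[maxe/-oo]_(a : A) (f a)%:E)%E.

Definition sup_norm (R : realType) (S : finType) (f : S -> R) : R :=
  \big[Num.max/0]_(s : S) `|f s|.

Record mdp (R : realType) (S A : finType) := Mdp {
  trans : S -> S -> A -> R;  (* [trans s' s a] is q(s'|s,a) *)
  reward : A -> S -> R;      (* [reward a s] is r(a|s) *)
  discount : R;
  trans_ge0 : forall s' s a, 0 <= trans s' s a;
  trans_sum1 : forall s a, \sum_(s' : S) trans s' s a = 1;
  discount_ge0 : 0 <= discount;
  discount_le1 : discount <= 1
}.

Section DSMDP.
Context (R : realType) (S A : finType) (M : mdp R S A).
(* [Xi s] is the ambiguity set Ξ_s; the ambiguity set Ξ = ⊗_s Ξ_s consists of the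
   joint laws, independent over states, whose marginal at each [s] is in [Xi s]. *)
Context (Xi : S -> set (noise_law R A)).

Local Notation q := (trans M).
Local Notation r := (reward M).
Local Notation gamma := (discount M).
Local Notation noise_vec := (#|A|.-tuple R).

Definition bellman (V : S -> R) (s : S) : \bar R :=
  ereal_sup [set (\int[d]_(e in [set: noise_vec])
     max_over (fun a => (r a s + noise_at e a
                         + gamma * \sum_(s' : S) q s' s a * V s')%R))%E
   | d in Xi s].

Definition phi (s : S) (w : A -> R) : \bar R :=
  ereal_sup [set (\int[d]_(e in [set: noise_vec])
     max_over (fun a => (w a + noise_at e a)%R))%E | d in Xi s].

Section Process.
Context (d : nat -> S -> noise_law R A) (psi : nat -> S -> noise_vec -> A).

Section Realization.
Context (dO : measure_display) (Omega : measurableType dO) (P : probability Omega R).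
Context (noise : nat -> S -> Omega -> noise_vec) (state : nat -> Omega -> S).

Definition action (t : nat) (o : Omega) : A :=
  psi t (state t o) (noise t (state t o) o).

(** σ-algebra generated by the noise at times < m and the states at times < n. *)
Definition history (m n : nat) : set (set Omega) :=
  <<s [set E | (exists t s B, [/\ (t < m)%N, measurable B & E = noise t s @^-1` B])
            \/ (exists t x, (t < n)%N /\ E = state t @^-1` [set x])] >>.

(** (noise, state) is, on (Omega, P), the noise and state process of the DS-MDP
    started at [s0]: given the past, the noise at time n has law ⊗_s [d n s], and
    given the past and the noise up to time n, the next state has law
    q(·|s_n, a_n). *)
Record ds_process (s0 : S) : Prop := DsProcess {
  noise_measurable : forall t s, measurable_fun [set: Omega] (noise t s);
  state_measurable : forall t x, measurable (state t @^-1` [set x]);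
  state_init : forall o, state 0%N o = s0;
  noise_cond_law : forall n H (B : S -> set noise_vec),
    history n n.+1 H -> (forall s, measurable (B s)) ->
    P (H `&` [set o | forall s, B s (noise n s o)])
      = (P H * \prod_(s : S) d n s (B s))%E;
  state_cond_law : forall n H x a y,
    history n.+1 n.+1 H ->
    P (H `&` [set o | [/\ state n o = x, action n o = a & state n.+1 o = y]])
      = ((q y x a)%:E * P (H `&` [set o | state n o = x /\ action n o = a]))%E
}.

Definition stage_reward (t : nat) (o : Omega) : R :=
  gamma ^+ t * (r (action t o) (state t o)
                + noise_at (noise t (state t o) o) (action t o)).

(** The expectation of the infinite discounted sum is meaningful in the sense of
    Lebesgue only if the sum of the absolute values is integrable. *)
Definition total_reward_integrable : Prop :=
  (\int[P]_(o in [set: Omega]) \sum_(0 <= t <oo) `|stage_reward t o|%:E < +oo)%E.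

Definition expected_total_reward : \bar R :=
  (\int[P]_(o in [set: Omega]) \sum_(0 <= t <oo) (stage_reward t o)%:E)%E.

End Realization.

(** The expectation of the total discounted reward from [s0], as a relation; its
    value depends only on the law of the process, not on the probability space. *)
Definition expected_value (s0 : S) (v : \bar R) : Prop :=
  exists (dO : measure_display) (Omega : measurableType dO)
         (P : probability Omega R)
         (noise : nat -> S -> Omega -> noise_vec) (state : nat -> Omega -> S),
    [/\ ds_process P noise state s0,
        total_reward_integrable P noise state
      & v = expected_total_reward P noise state].

End Process.

Definition ds_value (s0 : S) : \bar R :=
  ereal_sup [set v | exists (d : nat -> S -> noise_law R A)
                            (psi : nat -> S -> noise_vec -> A),
    [/\ forall t s, Xi s (d t s),
        forall t s a, measurable (psi t s @^-1` [set a])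
      & expected_value d psi s0 v]].

Definition opt_weight (s : S) (a : A) : R :=
  r a s + gamma * \sum_(s' : S) q s' s a * fine (ds_value s').

Definition argmax_rule (w : A -> R) (psi : noise_vec -> A) : Prop :=
  (forall a, measurable (psi @^-1` [set a])) /\
  (forall e b, w b + noise_at e b <= w (psi e) + noise_at e (psi e)).

Definition maximizing_seq (s : S) (w : A -> R) (D : nat -> noise_law R A) : Prop :=
  (forall n, Xi s (D n)) /\
  ((fun n => (\int[D n]_(e in [set: noise_vec])
      max_over (fun a => (w a + noise_at e a)%R))%E) @ \oo --> phi s w).

(** Weak convergence of distributions on R^{|A|}; the tuple type carries no
    topology, so continuity is that of ['rV[R]_#|A|]. *)
Definition weak_cvg (D : nat -> noise_law R A) (d : noise_law R A) : Prop :=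
  forall f : 'rV[R]_#|A| -> R,
    continuous f -> (exists K : R, forall v, `|f v| <= K) ->
    (fun n => (\int[D n]_(e in [set: noise_vec]) (f (\row_i tnth e i))%:E)%E) @ \oo
      --> (\int[d]_(e in [set: noise_vec]) (f (\row_i tnth e i))%:E)%E.

(** [d] attains the supremum defining [phi s w], possibly as a limit; constant
    sequences give the distributions of [Xi s] that attain it. *)
Definition attains_sup (s : S) (w : A -> R) (d : noise_law R A) : Prop :=
  exists2 D, maximizing_seq s w D & weak_cvg D d.

(** [pi a] is the probability that an argmax rule picks [a]: under a distribution
    attaining the supremum, or, since a maximizing sequence need not have a weak
    limit, in the limit along such a sequence. *)
Definition optimal_policy (s : S) (w : A -> R) (pi : A -> R) : Prop :=
  exists2 psi, argmax_rule w psi &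
    (exists2 d, attains_sup s w d & forall a, d (psi @^-1` [set a]) = (pi a)%:E) \/
    (exists2 D, maximizing_seq s w D &
       forall a, (fun n => D n (psi @^-1` [set a])) @ \oo --> (pi a)%:E).

Definition phi_slice (s : S) (w : A -> R) (a : A) (x : R) : R :=
  fine (phi s (fun b => if b == a then x else w b)).

(** ∂(phi s)/∂w_a at [w], meaningful where [partial_exists] holds. *)
Definition partial_exists (s : S) (w : A -> R) (a : A) : Prop :=
  derivable (phi_slice s w a) (w a) 1.

Definition partial_phi (s : S) (w : A -> R) (a : A) : R :=
  'D_1 (phi_slice s w a) (w a).

(** The distribution attaining the supremum is well determined: it is the limit
    of every maximizing sequence. *)
Definition sup_well_posed (s : S) (w : A -> R) (d : noise_law R A) : Prop :=
  forall D, maximizing_seq s w D -> weak_cvg D d.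

End DSMDP.

(* Main.v *)
Require Import Defs.
From HB Require Import structures.
From mathcomp Require Import all_boot all_order all_algebra.
From mathcomp Require Import all_classical all_reals all_analysis.
From mathcomp Require Import measurable_realfun ring lra.

Set Implicit Arguments.
Unset Strict Implicit.
Unset Printing Implicit Defensive.

Import Order.TTheory GRing.Theory Num.Theory.
Import numFieldNormedType.Exports.

Local Open Scope classical_set_scope.
Local Open Scope ring_scope.

(** The Bellman operator at [V] is [phi] evaluated at the weights
    [w_a = r(a|s) + gamma * sum_s' q(s'|s,a) V(s')]. For every law [d] the map
    [w |-> E_d (max_a (w_a + eps_a))] is monotone and commutes with adding a
    constant to [w], and both properties pass to the supremum over [d]; the
    weights are monotone in [V], and they turn a constant [c] into [gamma * c]
    because [q(.|s,a)] is a probability. So the operator is monotone and turns a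
    constant [c] into [gamma * c]; any such map is a [gamma]-contraction for the
    sup norm ([bellman_contraction]), and for [gamma < 1] iteration gives a fixed
    point [V] ([bellman_fixpoint]).

    It remains to see that the value function is [V]. Given [s_t = s],
    the noise at time [t] has law [d t s], and the next state is drawn from
    [q(.|s_t,a_t)]; hence for any admissible laws and decision rules
      [E (reward at t) + gamma^(t+1) E V(s_(t+1)) <= gamma^t E V(s_t)],
    and these inequalities telescope ([expected_total_reward_le]). Conversely,
    choose for each state a law that is almost optimal for the weights of [V],
    and play an argmax rule at all times: the inequalities are then reversed for
    [V] lowered by a small constant ([expected_total_reward_ge]). The supremum
    that defines the value function ranges over realizations of the process, so
    the lower bound needs one to exist ([stationary_process]). It lives on the
    space of infinite streams of noise vectors, with the product of a sequence of
    laws ([stream_law]): the product is defined on the events decided by finitely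
    many coordinates, and extended by the theorem of Caratheodory. What has to be
    shown is that a decreasing sequence of such events whose probabilities do
    not tend to zero has a common point, and this point is built one coordinate at
    a time ([nonvanishing_inter]).

    The formula for the optimal policy is an envelope argument. Raising the weight of [a] by [h] changes
    the maximum by an amount [max_gain h] that is bounded, is a continuous
    function of the noise, and is at least [h] where [a] is chosen and at least
    zero elsewhere, for both signs of [h]. Taking means along a maximizing sequence, the policy
    [pi] satisfies [phi(w + h e_a) - phi(w) >= h * pi a] for all [h]
    ([optimal_policy_subgradient]), so [pi a] is the partial derivative as soon as
    there is one. When every maximizing sequence tends to the same law [d], so do
    laws almost optimal at [w + h e_a] with [h] tending to zero; as the slopes of
    the convex function [h |-> max_gain h] are monotone, the difference quotients
    of [phi] are asymptotically bounded by the means of these slopes under [d]. If [d] has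
    a density, ties between actions have probability zero, and these means tend
    to the probability that [a] is chosen: the partial derivative exists
    ([well_posed_partial_exists]). *)

(** * The mean of the maximum and the Bellman operator *)

Lemma probability_integralDcst (d : measure_display) (T : measurableType d)
    (R : realType) (P : probability T R) (f : T -> R) (c : R) :
  P.-integrable [set: T] (EFin \o f) ->
  (\int[P]_(x in [set: T]) ((f x)%:E + c%:E) =
   \int[P]_(x in [set: T]) (f x)%:E + c%:E)%E.
Proof.
move=> fint; rewrite integralD //; last exact: finite_measure_integrable_cst.
by rewrite (integral_cst P measurableT) /= probability_setT mule1.
Qed.

(** [max_over] takes the value [-oo] only for empty [A]; for the other index sets
    nothing is lost by working with real numbers. *)
Definition fmax (R : realType) (A : finType) (f : A -> R) : R :=
  fine (max_over f).

Section FiniteMax.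
Context (R : realType) (A : finType).
Hypothesis A0 : (0 < #|A|)%N.
Implicit Types (f g w : A -> R).

Lemma fmax_attained f : exists2 a, max_over f = (f a)%:E & fmax f = f a.
Proof.
have [a0 _] := card_gt0P A0.
have [a _ aE] := @eq_bigmax _ _ A -oo%E a0 xpredT (fun a => (f a)%:E) erefl
  (fun i _ => leNye _).
have fE : max_over f = (f a)%:E by rewrite -aE.
by exists a => //; rewrite /fmax fE.
Qed.

Lemma max_overE f : max_over f = (fmax f)%:E.
Proof. by have [a -> ->] := fmax_attained f. Qed.

Lemma le_fmax f a : f a <= fmax f.
Proof. by rewrite -lee_fin -max_overE; exact: le_bigmax. Qed.

Lemma fmax_le f c : (forall a, f a <= c) -> fmax f <= c.
Proof. by move=> fc; have [a _ ->] := fmax_attained f. Qed.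

Lemma ler_fmax f g c : (forall a, f a <= g a + c) -> fmax f <= fmax g + c.
Proof.
by move=> fg; apply: fmax_le => a; rewrite (le_trans (fg a))// lerD2r le_fmax.
Qed.

Lemma fmaxD f c : fmax (fun a => f a + c) = fmax f + c.
Proof.
apply/eqP; rewrite eq_le ler_fmax //= -lerBrDr; apply: ler_fmax => a.
by rewrite addrK.
Qed.

Lemma fmax_lip f g c : (forall a, `|f a - g a| <= c) -> `|fmax f - fmax g| <= c.
Proof.
move=> fg; rewrite ler_distl lerBlDr !ler_fmax // => a;
  by move: (fg a); rewrite ler_distl lerBlDr => /andP[].
Qed.

Lemma eq_fmax f g : f =1 g -> fmax f = fmax g.
Proof. by move=> /funext ->. Qed.

End FiniteMax.

Section MaxExpectation.
Context (R : realType) (A : finType).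
Hypothesis A0 : (0 < #|A|)%N.
Local Notation noise_vec := (#|A|.-tuple R).
Implicit Types (w : A -> R) (d : noise_law R A).

Lemma measurable_noise_at (a : A) :
  measurable_fun [set: noise_vec] (fun e => noise_at e a).
Proof. exact: measurable_tnth. Qed.

Definition noisy_max w (e : noise_vec) : R := fmax (fun a => w a + noise_at e a).

Lemma measurable_noisy_max w : measurable_fun [set: noise_vec] (noisy_max w).
Proof.
apply/measurable_EFinP.
rewrite (_ : EFin \o _ = fun e => max_over (fun a => w a + noise_at e a)); last first.
  by apply/funext => e; rewrite max_overE.
rewrite /max_over; elim: (index_enum A) => [|a l IHl].
  by under eq_fun do rewrite big_nil; exact: measurable_cst.
under eq_fun do rewrite big_cons.
apply: measurable_maxe => //.
by apply/measurable_EFinP/measurable_funD => //; exact: measurable_noise_at.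
Qed.

Lemma noisy_maxD w c e : noisy_max (fun a => w a + c) e = noisy_max w e + c.
Proof. by rewrite /noisy_max -fmaxD //; congr fmax; apply/funext => a; rewrite addrAC. Qed.

Lemma ler_noisy_max w w' e : (forall a, w a <= w' a) -> noisy_max w e <= noisy_max w' e.
Proof.
by move=> ww'; rewrite -[leRHS]addr0; apply: ler_fmax => // a; rewrite addr0 lerD2r.
Qed.

Lemma noisy_max_lip w w' c e : (forall a, `|w a - w' a| <= c) ->
  `|noisy_max w e - noisy_max w' e| <= c.
Proof.
by move=> h; apply: fmax_lip => // a; rewrite opprD addrACA subrr addr0.
Qed.

Definition noise_integrable d :=
  d.-integrable [set: noise_vec] (fun e => max_over (noise_at e)).

(** The weights move the largest noise by a bounded amount only. *)
Lemma integrable_noisy_max d w : noise_integrable d ->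
  d.-integrable [set: noise_vec] (fun e => (noisy_max w e)%:E).
Proof.
move=> dint.
have dint' : d.-integrable [set: noise_vec]
    ((abse \o (fun e => max_over (noise_at e))) \+
     (EFin \o cst (fmax (fun a => `|w a|)%R)))%E.
  apply: integrableD => //; first exact: integrable_abse.
  exact: finite_measure_integrable_cst.
apply: le_integrable dint' => //.
  by apply/measurable_EFinP; exact: measurable_noisy_max.
move=> e _; rewrite /= max_overE // lee_fin (ger0_norm (addr_ge0 _ _)) //; last first.
  by have [a _ ->] := fmax_attained A0 (fun a => `|w a|).
have -> : fmax (noise_at e) = noisy_max (fun=> 0) e.
  by apply: eq_fmax => a; rewrite add0r.
rewrite -lerBlDl; apply: le_trans (lerB_dist _ _) _.
apply: noisy_max_lip => a; rewrite subr0.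
exact: le_fmax (fun a => `|w a|) a.
Qed.

Definition emax d w : \bar R :=
  (\int[d]_(e in [set: noise_vec]) (noisy_max w e)%:E)%E.

Lemma emaxE d w :
  (\int[d]_(e in [set: noise_vec]) max_over (fun a => (w a + noise_at e a)%R))%E
  = emax d w.
Proof. by apply: eq_integral => e _; rewrite max_overE. Qed.

Lemma emax_fin d w : noise_integrable d -> emax d w \is a fin_num.
Proof. by move=> dint; apply: integrable_fin_num => //; exact: integrable_noisy_max. Qed.

Lemma le_emax d w w' : noise_integrable d -> (forall a, w a <= w' a) ->
  (emax d w <= emax d w')%E.
Proof.
move=> dint ww'; apply: le_integral => //; try exact: integrable_noisy_max.
by move=> e _; rewrite lee_fin ler_noisy_max.
Qed.

Lemma emaxD d w c : noise_integrable d ->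
  emax d (fun a => w a + c) = (emax d w + c%:E)%E.
Proof.
move=> dint; under [emax d _]eq_integral do rewrite noisy_maxD EFinD.
exact/probability_integralDcst/integrable_noisy_max.
Qed.

End MaxExpectation.

Section Phi.
Context (R : realType) (S A : finType) (Xi : S -> set (noise_law R A)).
Hypothesis A0 : (0 < #|A|)%N.
Hypothesis Xi0 : forall s, Xi s !=set0.
Hypothesis Xi_int : forall s d, Xi s d -> noise_integrable d.
Implicit Types (w : A -> R) (s : S).

Lemma phiE s w : phi Xi s w = ereal_sup [set emax d w | d in Xi s].
Proof.
by rewrite /phi; congr ereal_sup; apply: eq_imagel => d _; rewrite emaxE.
Qed.

Lemma emax_le_phi s d w : Xi s d -> (emax d w <= phi Xi s w)%E.
Proof. by move=> Xd; rewrite phiE; apply: ereal_sup_ubound; exists d. Qed.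

Lemma phi_le s w x : (forall d, Xi s d -> (emax d w <= x)%E) -> (phi Xi s w <= x)%E.
Proof. by move=> h; rewrite phiE; apply: ge_ereal_sup => _ [d /h ? <-]. Qed.

Lemma le_phi s w w' : (forall a, w a <= w' a) -> (phi Xi s w <= phi Xi s w')%E.
Proof.
move=> ww'; apply: phi_le => d Xd; apply: le_trans (emax_le_phi w' Xd).
by apply: le_emax => //; exact: Xi_int Xd.
Qed.

Lemma phiD s w c : phi Xi s (fun a => w a + c) = (phi Xi s w + c%:E)%E.
Proof.
have h w' c' : (phi Xi s (fun a => w' a + c')%R <= phi Xi s w' + c'%:E)%E.
  apply: phi_le => d Xd; rewrite (emaxD A0 _ _ (Xi_int Xd)) leeD2r //.
  exact: emax_le_phi.
apply/eqP; rewrite eq_le h /= -leeBrDr //.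
have := h (fun a => w a + c) (- c); rewrite EFinN.
by under [X in phi _ _ X]funext do rewrite addrK.
Qed.

Lemma phi_gtNy s w : (-oo < phi Xi s w)%E.
Proof.
have [d Xd] := Xi0 s; apply: lt_le_trans (emax_le_phi w Xd).
by rewrite ltNye_eq emax_fin //; exact: Xi_int Xd.
Qed.

Lemma phi_lip_le s w w' c : (forall a, w a <= w' a + c) ->
  (phi Xi s w <= phi Xi s w' + c%:E)%E.
Proof. by move=> h; rewrite -phiD; exact: le_phi. Qed.

(** Any two weight vectors differ by a bounded amount. *)
Lemma phi_fin w0 s w : (phi Xi s w0 < +oo)%E -> phi Xi s w \is a fin_num.
Proof.
move=> h; rewrite fin_numElt phi_gtNy /=.
apply: le_lt_trans (lte_add_pinfty h (ltry (fmax (fun a => w a - w0 a)))).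
apply: phi_lip_le => a; rewrite -lerBlDl.
exact: le_fmax (fun a => w a - w0 a) a.
Qed.

(** Where [phi] is infinite it is so at all weights, and [fine] then makes both
    terms zero. *)
Lemma phi_lip s w w' (c : R) : (forall a, `|w a - w' a| <= c) ->
  `|fine (phi Xi s w) - fine (phi Xi s w')| <= c.
Proof.
move=> h.
have c0 : 0 <= c.
  by have [a _] := card_gt0P A0; exact: le_trans (h a).
have [wf|wNf] := boolP (phi Xi s w \is a fin_num); last first.
  have wy w'' : phi Xi s w'' = +oo%E.
    apply/eqP; rewrite -leye_eq leNgt; apply/negP => /(phi_fin w).
    by rewrite (negbTE wNf).
  by rewrite !wy subrr normr0.
have w'f : phi Xi s w' \is a fin_num.
  by apply: phi_fin; move: wf; rewrite fin_numElt => /andP[_]; apply.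
have le1 u u' : (forall a, `|u a - u' a| <= c) ->
    (phi Xi s u <= phi Xi s u' + c%:E)%E.
  by move=> uu; apply: phi_lip_le => a; rewrite -lerBlDl (le_trans (ler_norm _)).
have := le1 _ _ h.
have := le1 w' w; rewrite -(fineK wf) -(fineK w'f) -!EFinD !lee_fin => h1 h2.
rewrite ler_distl lerBlDr h2 andbT; apply: h1 => a.
by rewrite distrC.
Qed.

End Phi.

Section Bellman.
Context (R : realType) (S A : finType) (M : mdp R S A).
Context (Xi : S -> set (noise_law R A)).
Hypothesis A0 : (0 < #|A|)%N.
Hypothesis Xi0 : forall s, Xi s !=set0.
Hypothesis Xi_int : forall s d, Xi s d -> noise_integrable d.
Local Notation q := (trans M).
Local Notation gamma := (discount M).
Implicit Types V : S -> R.

Definition weight V s a : R :=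
  reward M a s + gamma * \sum_(s' : S) q s' s a * V s'.

Lemma bellmanE V s : bellman M Xi V s = phi Xi s (weight V s).
Proof.
rewrite /bellman /phi; congr ereal_sup; apply: eq_imagel => d _.
apply: eq_integral => e _; congr max_over; apply/funext => a.
by rewrite addrAC.
Qed.

Lemma le_weight V V' s a : (forall s, V' s <= V s) -> weight V' s a <= weight V s a.
Proof.
move=> h; rewrite lerD2l ler_wpM2l ?discount_ge0 // ler_sum // => s' _.
by rewrite ler_wpM2l ?trans_ge0.
Qed.

(** The factor [gamma] comes from [q(.|s,a)] having total mass one. *)
Lemma weightD V c s a : weight (fun s' => V s' + c) s a = weight V s a + gamma * c.
Proof.
rewrite /weight -addrA -mulrDr; congr (_ + _ * _).
under eq_bigr do rewrite mulrDr.
by rewrite big_split /= -mulr_suml trans_sum1 mul1r.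
Qed.

Lemma weight_lip V V' c s a : (forall s, `|V s - V' s| <= c) ->
  `|weight V s a - weight V' s a| <= gamma * c.
Proof.
have h U U' : (forall s, `|U s - U' s| <= c) -> weight U s a <= weight U' s a + gamma * c.
  move=> UU; rewrite -weightD; apply: le_weight => s'.
  by rewrite -lerBlDl (le_trans (ler_norm _)).
by move=> VV; rewrite ler_distl lerBlDr !h // => s'; rewrite distrC.
Qed.

Lemma le_bellman V V' s : (forall s, V' s <= V s) ->
  (bellman M Xi V' s <= bellman M Xi V s)%E.
Proof. by move=> VV; rewrite !bellmanE; apply: le_phi => // a; exact: le_weight. Qed.

Lemma bellmanD V c s :
  bellman M Xi (fun s' => V s' + c) s = (bellman M Xi V s + (gamma * c)%:E)%E.
Proof.
rewrite !bellmanE -phiD //; congr phi; apply/funext => a; exact: weightD.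
Qed.

Lemma le_sup_norm (f : S -> R) s : `|f s| <= sup_norm f.
Proof. exact: le_bigmax. Qed.

Lemma sup_norm_le (f : S -> R) c : 0 <= c -> (forall s, `|f s| <= c) -> sup_norm f <= c.
Proof. by move=> c0 fc; apply: bigmax_le. Qed.

Lemma sup_norm_ge0 (f : S -> R) : 0 <= sup_norm f.
Proof. exact: bigmax_ge_id. Qed.

Lemma bellman_contraction V V' :
  sup_norm (fun s => fine (bellman M Xi V s) - fine (bellman M Xi V' s))
  <= gamma * sup_norm (fun s => V s - V' s).
Proof.
apply: sup_norm_le => [|s]; first by rewrite mulr_ge0 ?discount_ge0 ?sup_norm_ge0.
rewrite !bellmanE; apply: phi_lip => // a; apply: weight_lip => s'.
exact: le_sup_norm (fun s => V s - V' s) s'.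
Qed.

Hypothesis phi_bounded : forall s, (phi Xi s (reward M ^~ s) < +oo)%E.

Lemma bellman_fin V s : bellman M Xi V s \is a fin_num.
Proof. by rewrite bellmanE; apply: phi_fin (phi_bounded s). Qed.

Hypothesis gamma1 : gamma < 1.

Lemma bellman_unique V V' : (forall s, bellman M Xi V s = (V s)%:E) ->
  (forall s, bellman M Xi V' s = (V' s)%:E) -> V = V'.
Proof.
move=> TV TV'; set n := sup_norm (fun s => V s - V' s).
have nn : n <= gamma * n.
  rewrite -{1}[n]/(sup_norm _); have := bellman_contraction V V'.
  by under [X in sup_norm X <= _ -> _]funext do rewrite TV TV'.
have n0 : n = 0.
  apply/eqP; rewrite eq_le sup_norm_ge0 andbT leNgt; apply/negP => n_gt0.
  by move: nn; rewrite leNgt gtr_pMl // gamma1.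
apply/funext => s; apply/eqP; rewrite -subr_eq0 -normr_eq0 eq_le normr_ge0 andbT -n0.
exact: le_sup_norm (fun s => V s - V' s) s.
Qed.

(** The increments of the iterates of the operator are dominated by a geometric
    sequence. *)
Lemma bellman_fixpoint : exists V, forall s, bellman M Xi V s = (V s)%:E.
Proof.
pose T V s := fine (bellman M Xi V s).
pose v n := iter n T (fun=> 0).
pose C := sup_norm (fun s => v 1%N s - v 0%N s).
have vC n s : `|v n.+1 s - v n s| <= gamma ^+ n * C.
  apply: le_trans (le_sup_norm (fun s => v n.+1 s - v n s) s) _.
  elim: n => [|n IHn]; first by rewrite mul1r.
  apply: le_trans (bellman_contraction (v n.+1) (v n)) _.
  by rewrite exprS -mulrA ler_wpM2l ?discount_ge0.
have v_cvg s : cvgn (fun n => v n s).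
  have -> : (fun n => v n s) =
      (fun n => v 0%N s + series (telescope (fun n => v n s)) n).
    by apply/funext => n; rewrite -eq_sum_telescope.
  apply: is_cvgD; first exact: is_cvg_cst.
  apply: normed_cvg; apply: (@series_le_cvg _ _ (geometric C gamma)) => n.
  - exact: normr_ge0.
  - by rewrite /geometric /= mulr_ge0 ?sup_norm_ge0 // exprn_ge0 // discount_ge0.
  - by rewrite /geometric /= mulrC; exact: vC.
  by apply: is_cvg_geometric_series; rewrite ger0_norm // discount_ge0.
pose V s := limn (fun n => v n s).
have TV s : T V s = V s.
  apply/eqP; rewrite -subr_eq0 -normr_le0; apply/ler_addgt0Pl => e e0.
  rewrite addr0.
  have e20 : 0 < e / 2 by rewrite divr_gt0.
  have : \forall n \near \oo, forall s', `|V s' - v n s'| <= e / 2.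
    apply: filter_forall => s'; have := v_cvg s'; move/cvgr_dist_le; exact.
  move=> nV.
  have [n [nV1 nV2]] : exists n, (forall s', `|V s' - v n s'| <= e / 2) /\
      (forall s', `|V s' - v n.+1 s'| <= e / 2).
    case: nV => n _ h; exists n; split; apply: h => //=.
  rewrite (splitr e) (le_trans (ler_distD (v n.+1 s) _ _)) // lerD //.
    apply: le_trans (le_sup_norm (fun s => T V s - T (v n) s) s) _.
    apply: le_trans (bellman_contraction _ _) _.
    rewrite -[leRHS]mul1r ler_pM ?discount_ge0 ?sup_norm_ge0 //; first exact: ltW.
    by apply: sup_norm_le => //; exact: ltW.
  by rewrite distrC.
by exists V => s; rewrite -TV /T fineK // bellman_fin.
Qed.

End Bellman.
(** * Measurable choice of an optimal action *)

Section FiniteValued.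
Context (d : measure_display) (T : measurableType d).

Lemma measurable_fin_preimage (F : finType) (X : T -> F) (B : set F) :
  (forall x, measurable (X @^-1` [set x])) -> measurable (X @^-1` B).
Proof.
move=> mX; rewrite (_ : _ @^-1` _ = \bigcup_(x in B) (X @^-1` [set x])).
  by apply: fin_bigcup_measurable => //; exact: finite_finset.
by apply/seteqP; split=> [t Bt|t [x Bx /= ->]] //; exists (X t).
Qed.

Lemma measurable_forall_fin (F : finType) (E : F -> set T) :
  (forall x, measurable (E x)) -> measurable [set t | forall x, E x t].
Proof.
move=> mE; rewrite (_ : [set t | _] = \bigcap_(x in [set: F]) E x).
  by apply: fin_bigcap_measurable => //; exact: finite_finset.
by apply/seteqP; split => t Et // x; exact: Et.
Qed.

(** An outcome of finitely many measurable tests has measurable preimages; rules that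
    choose an action, or decode a state, by comparing numbers are of this form. *)
Lemma measurable_bool_family (F : finType) (b : F -> T -> bool) (B : set {ffun F -> bool}) :
  (forall x, measurable [set t | b x t]) ->
  measurable [set t | B [ffun x => b x t]].
Proof.
move=> mb; apply: (@measurable_fin_preimage _ (fun t => [ffun x => b x t])) => v.
rewrite (_ : _ @^-1` _ = [set t | forall x, b x t = v x]); last first.
  apply/seteqP; split=> t /= => [<- x|h]; first by rewrite ffunE.
  by apply/ffunP => x; rewrite ffunE.
apply: measurable_forall_fin => x; case: (v x); first exact: mb.
rewrite (_ : (fun t => _ = false) = ~` [set t | b x t]); first exact: measurableC.
by apply/seteqP; split=> t /=; [move=> ->|move/negP/negbTE].
Qed.

End FiniteValued.

Section ArgmaxRule.
Context (R : realType) (A : finType).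
Hypothesis A0 : (0 < #|A|)%N.
Local Notation noise_vec := (#|A|.-tuple R).
Implicit Types (w : A -> R).

Lemma measurable_noise_le w a b :
  measurable [set e : noise_vec | w b + noise_at e b <= w a + noise_at e a].
Proof.
have m c : measurable_fun [set: noise_vec] (fun e => w c + noise_at e c).
  by apply: measurable_funD => //; exact: measurable_noise_at.
by have := measurable_fun_le measurableT (m b) (m a); rewrite setTI.
Qed.

(** Breaking ties by the enumeration of [A] makes the choice depend on finitely many
    comparisons only. *)
Lemma argmax_rule_exists w : exists psi, argmax_rule (R:=R) w psi.
Proof.
have [a0 _] := card_gt0P A0.
pose top (a : A) (e : noise_vec) :=
  [forall b, w b + noise_at e b <= w a + noise_at e a].
pose pick_top (v : {ffun A -> bool}) := odflt a0 [pick a | v a].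
exists (fun e => pick_top [ffun a => top a e]); split=> [a|e b].
  apply: (@measurable_bool_family _ _ _ _ [set v | pick_top v = a]) => c.
  rewrite (_ : [set t | _] = [set e | forall b, w b + noise_at e b <= w c + noise_at e c]).
    by apply: measurable_forall_fin => b; exact: measurable_noise_le.
  by apply/seteqP; split => e /= /forallP.
have [a _ aE] := fmax_attained A0 (fun a => w a + noise_at e a).
rewrite /pick_top; case: pickP => [c|/(_ a)] /=; first by rewrite ffunE => /forallP.
by rewrite ffunE => /negP[]; apply/forallP => c; rewrite -aE; exact: le_fmax (fun a => _) _.
Qed.

Lemma argmax_ruleE w psi (e : noise_vec) : argmax_rule w psi ->
  noisy_max w e = w (psi e) + noise_at e (psi e).
Proof.
case=> _ h; apply/eqP; rewrite eq_le fmax_le //=.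
exact: le_fmax (fun a => w a + noise_at e a) _.
Qed.

End ArgmaxRule.

(** * Raising the weight of one action *)

Section Raise.
Context (R : realType) (A : finType).
Hypothesis A0 : (0 < #|A|)%N.
Local Notation noise_vec := (#|A|.-tuple R).
Context (w : A -> R) (a : A).

Definition raise (h : R) : A -> R := fun b => if b == a then w a + h else w b.

(** Unlike the maxima themselves this difference is bounded, so that weak
    convergence applies to it. *)
Definition max_gain (h : R) (e : noise_vec) : R := noisy_max (raise h) e - noisy_max w e.

Lemma raise_lip h b : `|raise h b - w b| <= `|h|.
Proof.
rewrite /raise; case: eqP => [->|_]; first by rewrite addrC addKr.
by rewrite subrr normr0.
Qed.

Lemma max_gain_bound h e : `|max_gain h e| <= `|h|.
Proof. by apply: noisy_max_lip => // b; exact: raise_lip. Qed.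

Lemma measurable_max_gain h : measurable_fun [set: noise_vec] (max_gain h).
Proof. by apply: measurable_funB; exact: measurable_noisy_max. Qed.

(** The action chosen by [psi] is still available after the change of weights. *)
Lemma max_gain_ge psi h e : argmax_rule w psi ->
  h * \1_(psi @^-1` [set a]) e <= max_gain h e.
Proof.
move=> psiP; rewrite /max_gain (argmax_ruleE A0 e psiP) indicE lerBrDr.
apply: le_trans (le_fmax A0 (fun b => raise h b + noise_at e b) (psi e)).
rewrite /raise; have [<-|psia] := eqVneq (psi e) a.
  by rewrite mem_set //= mulr1; lra.
by rewrite memNset ?mulr0 ?add0r //= => /eqP; rewrite (negbTE psia).
Qed.

(** Without ties the best action leads by a positive margin, and a change of weight
    smaller than the margin does not alter the choice. *)
Lemma max_gain_eq psi (e : noise_vec) : argmax_rule w psi ->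
  (forall b c, b != c -> w b + noise_at e b != w c + noise_at e c) ->
  \forall h \near (0 : R), max_gain h e = h * \1_(psi @^-1` [set a]) e.
Proof.
move=> psiP ntie.
pose m := psi e.
have gap b : b != m -> 0 < (w m + noise_at e m) - (w b + noise_at e b).
  by move=> bm; rewrite subr_gt0 lt_neqAle ntie //; case: psiP => _ ->.
have : \forall h \near (0 : R), forall b, b != m ->
    `|h : R| <= (w m + noise_at e m) - (w b + noise_at e b).
  pose P b (h : R) := b != m -> `|h : R| <= (w m + noise_at e m) - (w b + noise_at e b).
  apply: (@filter_forall R A P (nbhs (0 : R))) => b.
  have [->|bm] := eqVneq b m; first by apply: filterE => h; rewrite /P eqxx.
  by apply: filterS (nbhs0_le (gap b bm)) => h hb _.
apply: filterS => h hb.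
apply/eqP; rewrite eq_le max_gain_ge // andbT /max_gain (argmax_ruleE A0 e psiP) -/m.
rewrite lerBlDr; apply: fmax_le => // b; rewrite indicE /raise.
have [ma|ma] := eqVneq m a.
  rewrite mem_set //= mulr1; have [->|ba] := eqVneq b a; first by rewrite ma; lra.
  have /hb : b != m by rewrite ma.
  by have := ler_norm (- h); rewrite normrN; lra.
rewrite memNset ?mulr0; last by move=> /= /eqP; rewrite -/m (negbTE ma).
rewrite add0r; have [->|ba] := eqVneq b a.
  have /hb : a != m by rewrite eq_sym.
  by have := ler_norm h; lra.
by case: psiP => _; apply.
Qed.

(** The function [h |-> max_gain h e] is convex and vanishes at zero, so its slopes
    at zero increase in each direction. *)
Lemma max_gain_slope s t eta e : 0 < t -> t <= eta ->
  max_gain (s * t) e <= t * (max_gain (s * eta) e / eta).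
Proof.
move=> t0 teta; have eta0 : 0 < eta by exact: lt_le_trans teta.
pose k := t / eta; have k0 : 0 <= k by rewrite divr_ge0 ?ltW.
have k1 : k <= 1 by rewrite ler_pdivrMr // mul1r.
rewrite [leRHS](_ : _ = k * max_gain (s * eta) e); last by rewrite /k mulrAC mulrA.
rewrite /max_gain lerBlDr; apply: fmax_le => // b.
have := le_fmax A0 (fun b => w b + noise_at e b) b.
have := le_fmax A0 (fun b => raise (s * eta) b + noise_at e b) b.
rewrite -/(noisy_max _ e) -/(noisy_max _ e) /raise.
have tE : t = k * eta by rewrite /k divfK // gt_eqF.
case: eqP => [->|_] h1 h2; rewrite ?tE; nra.
Qed.

End Raise.
(** * Ties have probability zero *)

Section TiesNull.
Context (R : realType).

Lemma lebesgue_tuple_set0 n : lebesgue_tuple (set0 : set (n.-tuple R)) = 0%E.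
Proof.
elim: n => [|n IHn] /=; first by rewrite indic0.
by apply: integral0_eq => x _; rewrite (_ : [set v | _] = set0).
Qed.

(** If the sliced coordinate is the one fixed to [c], all slices but one are empty,
    and a point has measure zero; otherwise the slices are again hyperplanes. *)
Lemma lebesgue_tuple_hyperplane n (j : 'I_n) (c : R) :
  lebesgue_tuple [set v : n.-tuple R | tnth v j = c] = 0%E.
Proof.
elim: n j => [[]//|n IHn] j /=.
case: (unliftP ord0 j) => [k|] ->.
  apply: integral0_eq => x _; rewrite -[RHS](IHn k); congr lebesgue_tuple.
  by apply/seteqP; split => v /=; rewrite tnthS.
set K := lebesgue_tuple [set: n.-tuple R].
transitivity (\int[lebesgue_measure]_(x in [set c]) (cst K x))%E; last first.
  exact: integral_set1.
rewrite [RHS]integral_mkcond; congr integral.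
apply/funext => x; rewrite patchE; case: ifPn => [|xc].
  by rewrite inE => ->; congr lebesgue_tuple; apply/seteqP; split => v //= _.
rewrite -[RHS](lebesgue_tuple_set0 n); congr lebesgue_tuple.
apply/seteqP; split => v //=; rewrite tnth0 => xc'.
by move: xc; rewrite notin_setE /=; apply.
Qed.

(** Slicing along the smaller of the two coordinates leaves a hyperplane. *)
Lemma lebesgue_tuple_tie n (i j : 'I_n) (c : R) : i != j ->
  lebesgue_tuple [set v : n.-tuple R | tnth v i = tnth v j + c] = 0%E.
Proof.
elim: n i j c => [[]//|n IHn] i j c /=.
case: (unliftP ord0 i) => [k|] ->; case: (unliftP ord0 j) => [l|] -> ij.
- apply: integral0_eq => x _; rewrite -[RHS](IHn k l c); last first.
    by apply: contra ij => /eqP ->.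
  by congr lebesgue_tuple; apply/seteqP; split => v /=; rewrite !tnthS.
- apply: integral0_eq => x _; rewrite -[RHS](lebesgue_tuple_hyperplane k (x + c)).
  by congr lebesgue_tuple; apply/seteqP; split => v /=; rewrite !tnthS tnth0.
- apply: integral0_eq => x _; rewrite -[RHS](lebesgue_tuple_hyperplane l (x - c)).
  congr lebesgue_tuple; apply/seteqP; split => v /=; rewrite !tnthS tnth0.
    by move=> ->; rewrite addrK.
  by move=> ->; rewrite subrK.
- by rewrite eqxx in ij.
Qed.

Context (A : finType).
Local Notation noise_vec := (#|A|.-tuple R).

Lemma measurable_tie (w : A -> R) b c :
  measurable [set e : noise_vec | w b + noise_at e b = w c + noise_at e c].
Proof.
rewrite (_ : [set e | _] = [set e : noise_vec | w b + noise_at e b <= w c + noise_at e c]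
    `&` [set e | w c + noise_at e c <= w b + noise_at e b]).
  by apply: measurableI; exact: measurable_noise_le.
apply/seteqP; split => e /=; first by move=> ->.
by move=> [h1 h2]; apply/eqP; rewrite eq_le h1 h2.
Qed.

Lemma continuous_law_tie (d : noise_law R A) (w : A -> R) b c : continuous_law d ->
  b != c -> d [set e : noise_vec | w b + noise_at e b = w c + noise_at e c] = 0%E.
Proof.
move=> dc bc; apply: dc; first exact: measurable_tie.
rewrite -(@lebesgue_tuple_tie _ (enum_rank b) (enum_rank c) (w c - w b)); last first.
  by rewrite (inj_eq enum_rank_inj).
congr lebesgue_tuple; apply/seteqP; split => e /=; rewrite /noise_at; lra.
Qed.

Lemma continuous_law_no_tie (d : noise_law R A) (w : A -> R) : continuous_law d ->
  {ae d, forall e : noise_vec, forall b c,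
    b != c -> w b + noise_at e b != w c + noise_at e c}.
Proof.
move=> dc.
pose P b c (e : noise_vec) := b != c -> w b + noise_at e b != w c + noise_at e c.
apply: (@filter_forall _ A (fun b e => forall c, P b c e)) => b.
apply: (@filter_forall _ A (fun c e => P b c e)) => c.
have [->|bc] := eqVneq b c; first by apply: filterE => e; rewrite /P eqxx.
exists [set e : noise_vec | w b + noise_at e b = w c + noise_at e c]; split.
- exact: measurable_tie.
- exact: continuous_law_tie.
- move=> e /= h; apply: contrapT => /eqP Ne; apply: h.
  by rewrite /P => _.
Qed.

End TiesNull.
(** * Partial derivatives of the supremum *)

Section Subgradient.
Context (R : realType) (f : R -> R) (x p : R).
Hypothesis fp : forall h, p * h <= f (x + h) - f x.

Lemma scaled_slope (h : R) : (f \o shift x) (h *: (1 : R)) - f x = f (x + h) - f x.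
Proof. congr (_ - _); rewrite /= addrC; congr (f (_ + _)); exact: mulr1. Qed.

(** An affine minorant that touches [f] at [x] bounds the difference quotients below
    on the right and above on the left. *)
Lemma derive_subgradient : derivable f x 1 -> 'D_1 f x = p.
Proof.
move=> dfx; set l := 'D_1 f x.
have lim_l : h^-1 *: ((f \o shift x) (h *: (1 : R)) - f x) @[h --> 0^'] --> l by [].
have close (e : R) : 0 < e -> exists2 r : R, 0 < r & forall h, `|h| < r -> h != 0 ->
    `|l - h^-1 * (f (x + h) - f x)| <= e.
  move=> e0; move/cvgr_dist_le : lim_l => /(_ e e0).
  move=> /nbhs_ballP[r /= r0 rP]; exists r => // h hr h0.
  have := rP h; rewrite /ball /= sub0r normrN => /(_ hr h0).
  by rewrite scaled_slope.
apply/eqP; rewrite eq_le; apply/andP; split; apply/ler_addgt0Pl => e /close[r r0 rP].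
  have r2 : 0 < r / 2 by rewrite divr_gt0.
  have := rP (- (r / 2)); rewrite normrN gtr0_norm // ltr_pdivrMr // ltr_pMr //.
  rewrite (_ : 1 < 2 :> R); last by rewrite ltr1n.
  rewrite oppr_eq0 gt_eqF // => /(_ isT isT).
  rewrite ler_distl => /andP[_ h]; rewrite (le_trans h) // addrC lerD2l.
  rewrite invrN mulNr lerNl mulrC ler_pdivlMr // mulNr -mulrN; exact: fp.
have r2 : 0 < r / 2 by rewrite divr_gt0.
have := rP (r / 2); rewrite gtr0_norm // ltr_pdivrMr // ltr_pMr //.
rewrite (_ : 1 < 2 :> R); last by rewrite ltr1n.
rewrite gt_eqF // => /(_ isT isT).
rewrite distrC ler_distl => /andP[_ h]; rewrite addrC; apply: le_trans h.
rewrite mulrC ler_pdivlMr //; exact: fp.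
Qed.

(** The affine minorant gives one bound on each one-sided difference quotient; the
    hypothesis, used for [s = 1] and [s = -1], gives the other. *)
Lemma derivable_subgradient :
  (forall s e : R, 0 < e ->
     exists2 r : R, 0 < r & forall t, 0 < t -> t < r ->
       f (x + s * t) - f x <= t * (s * p + e)) ->
  derivable f x 1.
Proof.
move=> up; apply/cvg_ex; exists p; apply/cvgrPdist_le => e e0.
have [r1 r10 h1] := up 1 e e0.
have [r2 r20 h2] := up (-1) e e0.
apply/nbhs_ballP; exists (Num.min r1 r2) => /=; first by rewrite lt_min r10 r20.
move=> h; rewrite /ball /= sub0r normrN lt_min => /andP[hr1 hr2] h0.
rewrite scaled_slope; set G := f (x + h) - f x; pose k := h^-1 * G.
rewrite -[_ *: _]/k.
have GE : G = h * k by rewrite /k mulrA divff // mul1r.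
have := fp h; rewrite -/G GE => L.
rewrite ler_distl; have [hgt|hlt|hE] := ltgtP h 0; last by rewrite hE eqxx in h0.
- move: hr2; rewrite (ltr0_norm hgt) => /(h2 _ _); rewrite oppr_gt0 hgt => /(_ isT).
  rewrite mulN1r opprK -/G GE => U.
  by apply/andP; split; rewrite -(ler_nM2l hgt); lra.
- move: hr1; rewrite (gtr0_norm hlt) => /(h1 _ hlt).
  rewrite mul1r -/G GE => U.
  by apply/andP; split; rewrite -(ler_pM2l hlt); lra.
Qed.

End Subgradient.

Section WeakLimits.
Context (R : realType) (A : finType).
Hypothesis A0 : (0 < #|A|)%N.
Local Notation noise_vec := (#|A|.-tuple R).

Lemma continuous_fmax_row (u : A -> R) :
  continuous (fun v : 'rV[R]_#|A| => fmax (fun b => u b + v ord0 (enum_rank b))).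
Proof.
move=> v; apply: (@cvgrPdist_le R R _ (nbhs v) _ _ _).2 => e e0.
have : \forall t \near nbhs v, forall b,
    `|v ord0 (enum_rank b) - (t : 'rV[R]_#|A|) ord0 (enum_rank b)| <= e.
  apply: (@filter_forall _ A (fun b (t : 'rV[R]_#|A|) =>
    `|v ord0 (enum_rank b) - t ord0 (enum_rank b)| <= e)) => b.
  have := @coord_continuous R 1 #|A| ord0 (enum_rank b) v.
  by move/(@cvgrPdist_le R R _ (nbhs v) _ _ _).1 => /(_ e e0).
apply: filterS => t ht; apply: fmax_lip => // b.
by rewrite opprD addrACA subrr add0r.
Qed.

(** As a function on row vectors, [max_gain] is continuous and bounded by [`|h|]. *)
Lemma weak_cvg_max_gain (D : nat -> noise_law R A) (d : noise_law R A) w a h :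
  weak_cvg D d ->
  (fun n => \int[D n]_(e in [set: noise_vec]) (max_gain w a h e)%:E)%E @ \oo -->
  (\int[d]_(e in [set: noise_vec]) (max_gain w a h e)%:E)%E.
Proof.
move=> Dd.
pose F (v : 'rV[R]_#|A|) := fmax (fun b => raise w a h b + v ord0 (enum_rank b))
  - fmax (fun b => w b + v ord0 (enum_rank b)).
have FE (e : noise_vec) : max_gain w a h e = F (\row_i tnth e i).
  by congr (_ - _); apply: eq_fmax => b; rewrite mxE.
under eq_fun do under eq_integral do rewrite FE.
under eq_integral do rewrite FE.
apply: Dd.
  by move=> v; exact: cvgB (@continuous_fmax_row _ v) (@continuous_fmax_row _ v).
exists `|h| => v; apply: fmax_lip => // b.
by rewrite opprD addrACA subrr addr0; exact: raise_lip.
Qed.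

Lemma integrable_max_gain (d : noise_law R A) w a h :
  d.-integrable [set: noise_vec] (fun e => (max_gain w a h e)%:E).
Proof.
have dint : d.-integrable [set: noise_vec] (EFin \o cst `|h|).
  exact: finite_measure_integrable_cst.
apply: le_integrable dint => //.
  by apply/measurable_EFinP; exact: measurable_max_gain.
by move=> e _; rewrite lee_fin /= [leRHS]normr_id max_gain_bound.
Qed.

Definition mean_gain (d : noise_law R A) w a h : R :=
  (\int[d]_(e in [set: noise_vec]) (max_gain w a h e))%R.

Lemma mean_gainE (d : noise_law R A) w a h :
  (\int[d]_(e in [set: noise_vec]) (max_gain w a h e)%:E)%E = (mean_gain d w a h)%:E.
Proof. by rewrite fineK //; apply: integrable_fin_num => //; exact: integrable_max_gain. Qed.

Lemma emax_raise (d : noise_law R A) w a h : noise_integrable d ->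
  emax d (raise w a h) = (emax d w + (mean_gain d w a h)%:E)%E.
Proof.
move=> dint; rewrite -mean_gainE /emax -integralD //; first last.
- exact: integrable_max_gain.
- exact: integrable_noisy_max.
by apply: eq_integral => e _; rewrite -EFinD /max_gain addrC subrK.
Qed.

Lemma le_mean_gain (d : noise_law R A) w a h (f : noise_vec -> R) :
  d.-integrable [set: noise_vec] (EFin \o f) ->
  (forall e, f e <= max_gain w a h e) ->
  (\int[d]_(e in [set: noise_vec]) f e)%R <= mean_gain d w a h.
Proof.
by move=> fint fle; apply: le_Rintegral => //; exact: integrable_max_gain.
Qed.

Lemma mean_gain_ge (d : noise_law R A) w a h psi : argmax_rule w psi ->
  h * fine (d (psi @^-1` [set a])) <= mean_gain d w a h.
Proof.
move=> psiP; have mpsi : measurable (psi @^-1` [set a]) by case: psiP.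
have ind_int : d.-integrable [set: noise_vec] (EFin \o \1_(psi @^-1` [set a])).
  exact: integrable_indic.
rewrite -[X in fine X](_ : (\int[d]_e (\1_(psi @^-1` [set a]) e)%:E = _)%E); last first.
  by rewrite integral_indic // setIT.
rewrite -[X in _ * X]/(Rintegral _ _ _) -RintegralZl //.
apply: le_mean_gain => [|e]; last exact: max_gain_ge.
exact: (integrableZl measurableT h ind_int).
Qed.

Lemma mean_gain_slope (d : noise_law R A) w a s t eta : 0 < t -> t <= eta ->
  mean_gain d w a (s * t) <= t * (mean_gain d w a (s * eta) / eta).
Proof.
move=> t0 teta; rewrite mulrCA [leRHS]mulrC /mean_gain.
rewrite -RintegralZl //; last exact: integrable_max_gain.
apply: le_Rintegral => //; first exact: integrable_max_gain.
  exact: (integrableZl measurableT _ (integrable_max_gain _ _ _ _)).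
by move=> e _; rewrite mulrAC -mulrA; exact: max_gain_slope.
Qed.

(** Off the null set of ties the slopes are eventually constant, by [max_gain_eq],
    and all are bounded by [`|s|]. *)
Lemma cvg_mean_gain_slope (d : noise_law R A) w a s psi : continuous_law d ->
  argmax_rule w psi ->
  (fun n : nat => mean_gain d w a (s * n.+1%:R^-1) / n.+1%:R^-1) @ \oo -->
  s * fine (d (psi @^-1` [set a])).
Proof.
move=> dc psiP; have mpsi : measurable (psi @^-1` [set a]) by case: psiP.
have ind_int : d.-integrable [set: noise_vec] (EFin \o \1_(psi @^-1` [set a])).
  exact: integrable_indic.
pose f n (e : noise_vec) : \bar R := (max_gain w a (s * n.+1%:R^-1) e * n.+1%:R)%:E.
have dom := @dominated_convergence _ _ _ d _ measurableT f
  (fun e => (s * \1_(psi @^-1` [set a]) e)%:E) (cst `|s|%:E).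
have [] := dom.
- move=> n; apply/measurable_EFinP; apply: measurable_funM => //.
  exact: measurable_max_gain.
- apply/measurable_EFinP; apply: measurable_funM => //.
- apply: filterS (continuous_law_no_tie w dc) => e ntie _.
  apply: cvg_near_cst.
  have h0 : (fun n : nat => s * n.+1%:R^-1) @ \oo --> (0 : R).
    by rewrite -(mulr0 s); apply: cvgMr; exact: cvg_harmonic.
  have [N _ hN] := h0 _ (max_gain_eq A0 a psiP ntie).
  exists N => // n /hN /= gainE; rewrite /f gainE.
  by rewrite mulrAC divfK.
- exact: finite_measure_integrable_cst.
- apply: aeW => e n _; rewrite lee_fin normrM.
  rewrite -ler_pdivlMr ?normr_gt0 // (le_trans (max_gain_bound A0 _ _ _ _)) //.
  by rewrite normrM normfV.
move=> _ _; rewrite [X in _ --> X -> _](_ : _ = (s * fine (d (psi @^-1` [set a])))%:E).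
  move=> /fine_cvg; apply: cvg_trans; apply: near_eq_cvg; apply: nearW => n /=.
  by rewrite invrK /mean_gain -RintegralZr //; exact: integrable_max_gain.
under eq_integral do rewrite EFinM.
rewrite integralZl // integral_indic // setIT EFinM fineK //.
exact: fin_num_measure.
Qed.

End WeakLimits.

Section PhiDerivative.
Context (R : realType) (S A : finType) (Xi : S -> set (noise_law R A)).
Hypothesis A0 : (0 < #|A|)%N.
Hypothesis Xi0 : forall s, Xi s !=set0.
Hypothesis Xi_int : forall s d, Xi s d -> noise_integrable d.
Context (s : S) (w : A -> R).
Hypothesis phi_w : (phi Xi s w < +oo)%E.
Local Notation noise_vec := (#|A|.-tuple R).

Lemma phi_sliceE a h : phi_slice Xi s w a (w a + h) = fine (phi Xi s (raise w a h)).
Proof. by []. Qed.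

Lemma phi_slice0 a : phi_slice Xi s w a (w a) = fine (phi Xi s w).
Proof.
by congr (fine (phi _ _ _)); apply/funext => b; case: eqP => [->|].
Qed.

Lemma emax_le_phi_raise d a h : Xi s d ->
  fine (emax d w) + mean_gain d w a h <= phi_slice Xi s w a (w a + h).
Proof.
move=> Xd; have dint := Xi_int Xd; rewrite phi_sliceE -lee_fin fineK; last exact: phi_fin phi_w.
rewrite EFinD fineK ?emax_fin // -emax_raise //; exact: emax_le_phi.
Qed.

Lemma maximizing_cvg D : maximizing_seq Xi s w D ->
  (fun n => fine (emax (D n) w)) @ \oo --> fine (phi Xi s w).
Proof.
case=> XD; under eq_fun do rewrite emaxE //.
rewrite -(fineK (phi_fin A0 Xi0 Xi_int w phi_w)).
exact: fine_cvg.
Qed.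

(** Along a maximizing sequence the means at [w] tend to [phi w] and the mean gains
    to the mean gain under the weak limit; their sums stay below [phi] at the
    raised weights. *)
Lemma attains_sup_gain d a h : attains_sup Xi s w d ->
  fine (phi Xi s w) + mean_gain d w a h <= phi_slice Xi s w a (w a + h).
Proof.
move=> [D Dmax Dd].
have gain_lim : mean_gain (D n) w a h @[n --> \oo] --> mean_gain d w a h.
  have := @weak_cvg_max_gain _ _ A0 _ _ w a h Dd.
  by rewrite mean_gainE // => /fine_cvg.
apply: (cvgr_to_le (cvgD (maximizing_cvg Dmax) gain_lim)).
by apply: nearW => n; apply: emax_le_phi_raise; exact: Dmax.1.
Qed.

Lemma attains_sup_subgradient d psi a h : attains_sup Xi s w d -> argmax_rule w psi ->
  fine (d (psi @^-1` [set a])) * h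
    <= phi_slice Xi s w a (w a + h) - phi_slice Xi s w a (w a).
Proof.
move=> dsup psiP; rewrite phi_slice0 mulrC lerBrDl.
apply: le_trans (attains_sup_gain a h dsup).
by rewrite lerD2l mean_gain_ge.
Qed.

(** For a weak limit the gain is minorized after passing to the limit, since the
    event that [psi] chooses [a] need not be a continuity set of the limit; for
    limits of probabilities it is minorized before. *)
Lemma optimal_policy_subgradient pi a h : optimal_policy Xi s w pi ->
  pi a * h <= phi_slice Xi s w a (w a + h) - phi_slice Xi s w a (w a).
Proof.
move=> [psi psiP [[d dsup dpi]|[D Dmax Dpi]]].
  by have := attains_sup_subgradient a h dsup psiP; rewrite dpi.
rewrite phi_slice0 mulrC lerBrDl.
have pi_lim : h * fine (D n (psi @^-1` [set a])) @[n --> \oo] --> h * pi a.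
  by apply: cvgMr; exact: (fine_cvg (Dpi a)).
apply: (cvgr_to_le (cvgD (maximizing_cvg Dmax) pi_lim)).
apply: nearW => n /=; apply: le_trans (emax_le_phi_raise a h (Dmax.1 n)).
by rewrite lerD2l mean_gain_ge.
Qed.

Lemma derive_optimal_policy pi a : optimal_policy Xi s w pi ->
  partial_exists Xi s w a -> pi a = partial_phi Xi s w a.
Proof.
move=> pi_opt pe; rewrite /partial_phi (derive_subgradient (p := pi a)) // => h.
exact: optimal_policy_subgradient.
Qed.

Lemma near_maximizer (u : A -> R) e : 0 < e ->
  exists2 d, Xi s d & fine (phi Xi s u) - e <= fine (emax d u).
Proof.
move=> e0; have uf := phi_fin A0 Xi0 Xi_int u phi_w.
move: (uf); rewrite {1}phiE // => /(ub_ereal_sup_adherent e0)[_ [d Xd <-]].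
rewrite -phiE // -(fineK uf) -(fineK (emax_fin A0 u (Xi_int Xd))) -EFinB lte_fin.
by exists d => //; exact: ltW.
Qed.

Lemma fine_emax_lip d (u v : A -> R) c : noise_integrable d ->
  (forall b, u b <= v b + c) -> fine (emax d u) <= fine (emax d v) + c.
Proof.
move=> dint uv; rewrite -lee_fin EFinD !fineK ?emax_fin // -emaxD //.
exact: le_emax.
Qed.

(** A change of weights by at most [c] moves [phi] and the means by at most [c]. *)
Lemma maximizing_seq_nearby (u : nat -> A -> R) (c : nat -> R) D :
  (forall n, Xi s (D n)) ->
  (forall n b, `|u n b - w b| <= c n) ->
  (forall n, fine (phi Xi s (u n)) - c n <= fine (emax (D n) (u n))) ->
  c @ \oo --> (0 : R) -> maximizing_seq Xi s w D.
Proof.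
move=> XD uw Du c0; split=> //.
have wf := phi_fin A0 Xi0 Xi_int w phi_w.
have Dint n : noise_integrable (D n) by exact: Xi_int (XD n).
under eq_fun do rewrite emaxE //; rewrite -(fineK wf).
apply: cvg_EFin; first by apply: nearW => n; exact: emax_fin.
(* one c n for the choice of D n, two for moving the mean and phi back to w *)
apply: (@squeeze_cvgr _ _ _ _ (fun n => fine (phi Xi s w) - 3 * c n)
  (fun=> fine (phi Xi s w))); last exact: cvg_cst.
  apply: nearW => n /=; apply/andP; split; last first.
    by rewrite -lee_fin !fineK ?emax_fin //; exact: emax_le_phi.
  have h1 : fine (emax (D n) (u n)) <= fine (emax (D n) w) + c n.
    apply: fine_emax_lip => // b; rewrite -lerBlDl.
    by rewrite (le_trans _ (uw n b)) // ler_norm.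
  have := phi_lip A0 Xi0 Xi_int s (uw n); rewrite ler_distl => /andP[h2 _].
  have := Du n; lra.
rewrite -[X in _ --> X]subr0 -(mulr0 3); apply: cvgB; first exact: cvg_cst.
exact: cvgMr.
Qed.

Lemma well_posed_attains d : sup_well_posed Xi s w d -> attains_sup Xi s w d.
Proof.
move=> dwp.
have /choice[D DP] : forall n : nat, exists D,
    Xi s D /\ fine (phi Xi s w) - n.+1%:R^-1 <= fine (emax D w).
  move=> n; have n0 : 0 < n.+1%:R^-1 :> R by rewrite invr_gt0.
  by have [D XD De] := near_maximizer w n0; exists D.
have Dmax : maximizing_seq Xi s w D.
  apply: (@maximizing_seq_nearby (fun=> w) (fun n => n.+1%:R^-1)) => [n|n b|n|].
  - by have [] := DP n.
  - by rewrite subrr normr0 invr_ge0.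
  - by have [] := DP n.
  - exact: cvg_harmonic.
by exists D => //; exact: dwp.
Qed.

(** Otherwise there are [t_k] tending to zero that violate the bound, and almost
    optimal laws for the weights raised by [sg * t_k]. These laws form a maximizing
    sequence at [w], so they tend to [d]. Their mean slopes at [t_k] are at most
    those at a fixed [eta], which tend to the slope under [d]; for small [eta] this
    contradicts the violated bound. *)
Lemma well_posed_upper d psi a sg e : continuous_law d -> sup_well_posed Xi s w d ->
  argmax_rule w psi -> 0 < e ->
  exists2 r : R, 0 < r & forall t, 0 < t -> t < r ->
    phi_slice Xi s w a (w a + sg * t) - phi_slice Xi s w a (w a)
      <= t * (sg * fine (d (psi @^-1` [set a])) + e).
Proof.
move=> dc dwp psiP e0; set p := fine _.
have e30 : 0 < e / 3 by rewrite divr_gt0.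
(* eta and the near-maximizers each take a third of e; the last third is the contradiction *)
have [eta eta0 eta_le] : exists2 eta : R, 0 < eta &
    mean_gain d w a (sg * eta) / eta <= sg * p + e / 3.
  have /cvgr_dist_le /(_ _ e30)[N _ hN] := @cvg_mean_gain_slope _ _ A0 d w a sg psi dc psiP.
  exists N.+1%:R^-1; first by rewrite invr_gt0.
  by have := hN N (leqnn N); rewrite /= distrC ler_distl => /andP[_]; rewrite -/p.
apply: contrapT => no_r.
have /choice[t tP] : forall k : nat, exists t, [/\ 0 < t, t < k.+1%:R^-1 &
    t * (sg * p + e) < phi_slice Xi s w a (w a + sg * t) - phi_slice Xi s w a (w a)].
  move=> k; apply: contrapT => no_t; apply: no_r; exists k.+1%:R^-1.
    by rewrite invr_gt0.
  move=> t t0 tk; rewrite leNgt; apply/negP => h; apply: no_t; by exists t.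
have /choice[D DP] : forall k : nat, exists D, Xi s D /\
    fine (phi Xi s (raise w a (sg * t k))) - t k * (e / 3)
      <= fine (emax D (raise w a (sg * t k))).
  move=> k; have [tk0 _ _] := tP k.
  by have [D XD De] := near_maximizer (raise w a (sg * t k)) (mulr_gt0 tk0 e30); exists D.
have Dmax : maximizing_seq Xi s w D.
  apply: (@maximizing_seq_nearby (fun k => raise w a (sg * t k))
    (fun k => (`|sg| + e / 3) * k.+1%:R^-1)) => [k|k b|k|].
  - by have [] := DP k.
  - have [t0 tk _] := tP k; apply: le_trans (raise_lip _ _ _ _) _.
    rewrite normrM (gtr0_norm t0) ler_pM ?(ltW t0) ?(ltW tk) //.
    by rewrite lerDl ltW.
  - have [t0 tk _] := tP k; apply: le_trans (DP k).2; rewrite lerD2l lerN2 mulrC.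
    by rewrite ler_pM ?(ltW t0) ?(ltW tk) ?(ltW e30) ?lerDr.
  - by rewrite -(mulr0 (`|sg| + e / 3)); apply: cvgMr; exact: cvg_harmonic.
have gain_lim : mean_gain (D n) w a (sg * eta) / eta @[n --> \oo]
    --> mean_gain d w a (sg * eta) / eta.
  apply: cvgMl; have := @weak_cvg_max_gain _ _ A0 _ _ w a (sg * eta) (dwp _ Dmax).
  by rewrite mean_gainE // => /fine_cvg.
suff : sg * p + e * (2 / 3) <= mean_gain d w a (sg * eta) / eta by lra.
apply: cvgr_to_ge gain_lim _.
have : \forall k \near \oo, k.+1%:R^-1 <= eta :> R.
  have /cvgr_dist_le/(_ _ eta0) := @cvg_harmonic R.
  by apply: filterS => k; rewrite sub0r normrN ger0_norm // invr_ge0.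
apply: filterS => k keta; have [t0 tk U] := tP k; have [XD De] := DP k.
have Dint := Xi_int XD.
have slope := mean_gain_slope A0 (D k) w a sg t0 (le_trans (ltW tk) keta).
move: De U; rewrite phi_sliceE phi_slice0 emax_raise // fineD ?emax_fin // /=.
have : fine (emax (D k) w) <= fine (phi Xi s w).
  rewrite -lee_fin !fineK ?emax_fin //; first exact: emax_le_phi.
  exact: phi_fin phi_w.
move=> h1 h2 h3; rewrite -(ler_pM2l t0); lra.
Qed.

Lemma well_posed_partial_exists d a : continuous_law d -> sup_well_posed Xi s w d ->
  partial_exists Xi s w a.
Proof.
move=> dc dwp; have [psi psiP] := argmax_rule_exists A0 w.
apply: (derivable_subgradient (p := fine (d (psi @^-1` [set a])))) => [h|sg e e0].
  by apply: attains_sup_subgradient => //; exact: well_posed_attains.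
exact: well_posed_upper.
Qed.

End PhiDerivative.
(** * Infinite products of probability laws *)

Section Streams.
Context (d : measure_display) (T : measurableType d).

Definition coordinate_sets (n : nat) : set (set (nat -> T)) :=
  [set X | exists i B, [/\ (i < n)%N, measurable B & X = (fun x : nat -> T => x i) @^-1` B]].

Definition cylinder_before (n : nat) : set (set (nat -> T)) := <<s coordinate_sets n >>.

Definition cylinder : set (set (nat -> T)) := [set X | exists n, cylinder_before n X].

Lemma cylinder_beforeW m n : (m <= n)%N -> cylinder_before m `<=` cylinder_before n.
Proof.
move=> mn; apply: sub_smallest2r; first exact: smallest_sigma_algebra.
move=> X [i [B [im mB ->]]]; exists i, B; split => //; exact: leq_trans mn.
Qed.

Lemma cylinder_before_coord n i (B : set T) : (i < n)%N -> measurable B ->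
  cylinder_before n ((fun x : nat -> T => x i) @^-1` B).
Proof. by move=> ? ?; apply: sub_sigma_algebra; exists i, B. Qed.

(** Without coordinates to observe only the trivial events can be decided. *)
Lemma cylinder_before0 X : cylinder_before 0 X -> X = set0 \/ X = setT.
Proof.
apply: (@smallest_sub _ _ _ [set X | X = set0 \/ X = setT]); last first.
  by move=> Y [i [B []]].
split=> /=.
- by left.
- by move=> Y [->|->]; [right; exact: setD0|left; exact: setDv].
- move=> F FP; have [[i Fi]|noF] := pselect (exists i, F i = setT).
    by right; rewrite -subTset => x _; exists i => //; rewrite Fi.
  left; rewrite -subset0 => x [i _]; case: (FP i) => [->//|Fi].
  by case: noF; exists i.
Qed.

Lemma cylinder0 : cylinder set0.
Proof. by exists 0%N; have [] := smallest_sigma_algebra setT (coordinate_sets 0). Qed.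

Lemma cylinderU : setU_closed cylinder.
Proof.
move=> X Y [m mX] [n nY]; exists (maxn m n).
have [s0 sC sU] := smallest_sigma_algebra setT (coordinate_sets (maxn m n)).
have -> : X `|` Y = \bigcup_i (if i is 0%N then X else Y).
  apply/seteqP; split=> [x [Xx|Yx]|x [[|i] _ ?]].
  - by exists 0%N.
  - by exists 1%N.
  - by left.
  - by right.
apply: sU => -[|i]; first exact: cylinder_beforeW (leq_maxl _ _) _ mX.
exact: cylinder_beforeW (leq_maxr _ _) _ nY.
Qed.

Lemma cylinderC : setC_closed cylinder.
Proof.
move=> X [n nX]; exists n; rewrite -setTD.
by have [_ + _] := smallest_sigma_algebra setT (coordinate_sets n); apply.
Qed.

(** Two names for the same functions: this one carries the algebra of cylinders,
    [stream_space] the sigma-algebra that it generates. *)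
Definition stream : Type := nat -> T.
HB.instance Definition _ := Pointed.on stream.

End Streams.

Definition cylinder_display : measure_display -> measure_display.
Proof. exact. Qed.

HB.instance Definition _ (d : measure_display) (T : measurableType d) :=
  @isAlgebraOfSets.Build (cylinder_display d) (stream T) (@cylinder d T)
    (@cylinder0 d T) (@cylinderU d T) (@cylinderC d T).

Definition stream_space (d : measure_display) (T : measurableType d) :=
  g_sigma_algebraType (@measurable _ (stream T)).

Lemma preimage_generated_measurable (d : measure_display) (T : measurableType d)
    (U : Type) (G : set (set U)) (f : T -> U) :
  (forall X, G X -> measurable (f @^-1` X)) ->
  forall X, <<s G >> X -> measurable (f @^-1` X).
Proof.
move=> Gf; apply: (@smallest_sub _ _ _ [set X | measurable (f @^-1` X)]) => //.
split=> /= [|X mX|F mF].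
- by rewrite preimage_set0.
- by rewrite setTD preimage_setC; exact: measurableC.
- by rewrite preimage_bigcup; exact: bigcupT_measurable.
Qed.

Section Cons.
Context (d : measure_display) (T : measurableType d).

Definition scons (y : T) (x : nat -> T) : nat -> T :=
  fun i => if i is j.+1 then x j else y.

Definition section (y : T) (X : set (nat -> T)) : set (nat -> T) := scons y @^-1` X.

Lemma cylinder_section n y X : cylinder_before n.+1 X -> cylinder_before n (section y X).
Proof.
apply: (@preimage_generated_measurable _ (g_sigma_algebraType (@coordinate_sets d T n))).
move=> _ [[|i] [B [im mB ->]]]; last exact: (@cylinder_before_coord _ T n i B im mB).
have [By|By] := pselect (B y).
  by rewrite (_ : _ @^-1` _ = setT) //; apply/seteqP; split.
by rewrite (_ : _ @^-1` _ = set0) //; apply/seteqP; split.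
Qed.

Lemma measurable_cylinder_before n (X : set (stream_space T)) :
  cylinder_before n X -> measurable X.
Proof. by move=> nX; apply: sub_sigma_algebra; exists n. Qed.

Lemma measurable_coord i : measurable_fun [set: stream_space T] (fun x => x i).
Proof.
move=> _ B mB; rewrite setTI; apply: (@measurable_cylinder_before i.+1).
exact: cylinder_before_coord.
Qed.

Definition scons_pair (p : T * stream_space T) : stream_space T := scons p.1 p.2.

Lemma measurable_scons : measurable_fun [set: T * stream_space T] scons_pair.
Proof.
move=> _ X mX; rewrite setTI; move: X mX.
apply: preimage_generated_measurable => X [n].
apply: (@preimage_generated_measurable _ (T * stream_space T)%type) => {X}.
move=> _ [[|i] [B [im mB ->]]].
  by rewrite -[_ @^-1` _]setTI; exact: measurable_fst.
rewrite -[_ @^-1` _]setTI.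
exact: (measurableT_comp (measurable_coord i) measurable_snd).
Qed.

HB.instance Definition _ := @isMeasurableFun.Build _ _ _ _ scons_pair measurable_scons.

End Cons.

Section FiniteLaws.
Context (d : measure_display) (T : measurableType d) (R : realType).
Context (mu : nat -> probability T R).

(** Law of [y_k, .., y_(k+n-1), point, point, ..] for independent [y_i] of law
    [mu i]. Being genuine measures on the space of streams, these laws provide
    the measurability of their sections in the prefixed coordinate. *)
Fixpoint fin_law (k n : nat) : probability (stream_space T) R :=
  if n is m.+1 then
    distribution (mu k \x fin_law k.+1 m)%E (@scons_pair d T)
  else dirac (point : stream_space T).

Lemma xsection_scons y (X : set (nat -> T)) :
  xsection (@scons_pair d T @^-1` X) y = section y X.
Proof. by apply/seteqP; split => x; rewrite /xsection /= inE. Qed.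

Lemma fin_lawS k n (X : set (nat -> T)) :
  fin_law k n.+1 X = (\int[mu k]_(y in [set: T]) fin_law k.+1 n (section y X))%E.
Proof. by apply: eq_integral => y _ /=; rewrite xsection_scons. Qed.

Lemma measurable_section_law k n (X : set (stream_space T)) : measurable X ->
  measurable_fun [set: T] (fun y => fin_law k n (section y X)).
Proof.
move=> mX.
have -> : (fun y => fin_law k n (section y X)) =
    (fin_law k n \o xsection (@scons_pair d T @^-1` X)).
  by apply/funext => y /=; rewrite xsection_scons.
apply: measurable_fun_xsection; rewrite -[_ @^-1` _]setTI; exact: measurable_scons.
Qed.

(** An event decided by [m] coordinates does not see where the stream is frozen
    after them. *)
Lemma fin_law_stable k m n (X : set (nat -> T)) : (m <= n)%N ->
  cylinder_before m X -> fin_law k n X = fin_law k m X.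
Proof.
elim: m n k X => [|m IHm] [|n] k X // mn mX.
  have [->|->] := cylinder_before0 mX; first by rewrite !measure0.
  by rewrite !probability_setT.
rewrite !fin_lawS; apply: eq_integral => y _; apply: IHm => //.
exact: cylinder_section.
Qed.

(** By [fin_law_stable] any number of coordinates that decides [X] gives the same
    value. *)
Definition stream_premeasure (k : nat) (X : set (stream T)) : \bar R :=
  fin_law k (xget 0%N [set n | cylinder_before n X]) X.

Lemma stream_premeasureE k n (X : set (nat -> T)) : cylinder_before n X ->
  stream_premeasure k X = fin_law k n X.
Proof.
move=> nX; rewrite /stream_premeasure; set m := xget _ _.
have mX : cylinder_before m X by exact: (@xgetPex _ 0%N [set n | cylinder_before n X] (ex_intro _ n nX)).
by rewrite -(fin_law_stable k (leq_maxl m n)) // (fin_law_stable k (leq_maxr m n)).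
Qed.

Lemma stream_premeasure_section k (X : set (nat -> T)) : cylinder X ->
  stream_premeasure k X =
  (\int[mu k]_(y in [set: T]) stream_premeasure k.+1 (section y X))%E.
Proof.
move=> [n nX]; have n1X := cylinder_beforeW (leqnSn n) nX.
rewrite (stream_premeasureE _ n1X) fin_lawS; apply: eq_integral => y _.
rewrite (@stream_premeasureE _ n) //; exact: cylinder_section.
Qed.

Lemma measurable_section_premeasure k (X : set (nat -> T)) : cylinder X ->
  measurable_fun [set: T] (fun y => stream_premeasure k (section y X)).
Proof.
move=> [n nX]; have n1X := cylinder_beforeW (leqnSn n) nX.
have -> : (fun y => stream_premeasure k (section y X)) =
    (fun y => fin_law k n (section y X)).
  by apply/funext => y; apply: stream_premeasureE; exact: cylinder_section.
by apply: measurable_section_law; exact: measurable_cylinder_before nX.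
Qed.

Lemma stream_premeasure0 k : stream_premeasure k set0 = 0%E.
Proof. exact: measure0. Qed.

Lemma stream_premeasure_ge0 k X : (0 <= stream_premeasure k X)%E.
Proof. exact: measure_ge0. Qed.

Lemma stream_premeasureT k : stream_premeasure k setT = 1%E.
Proof. exact: probability_setT. Qed.

Lemma cylinder2 (X Y : set (nat -> T)) : cylinder X -> cylinder Y ->
  exists n, cylinder_before n X /\ cylinder_before n Y.
Proof.
move=> [m mX] [n nY]; exists (maxn m n); split.
  exact: cylinder_beforeW (leq_maxl _ _) _ mX.
exact: cylinder_beforeW (leq_maxr _ _) _ nY.
Qed.

Lemma le_stream_premeasure k (X Y : set (nat -> T)) : cylinder X -> cylinder Y ->
  X `<=` Y -> (stream_premeasure k X <= stream_premeasure k Y)%E.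
Proof.
move=> cX cY XY; have [n [nX nY]] := cylinder2 cX cY.
rewrite !(@stream_premeasureE _ n) //.
have [mX mY] := (measurable_cylinder_before nX, measurable_cylinder_before nY).
by apply: le_measure => //; apply: mem_set.
Qed.

Lemma stream_premeasure_le1 k (X : set (nat -> T)) : cylinder X ->
  (stream_premeasure k X <= 1)%E.
Proof.
move=> [n nX]; rewrite (stream_premeasureE _ nX).
by apply: probability_le1; exact: measurable_cylinder_before nX.
Qed.

Lemma cylinder_sectionC y (X : set (nat -> T)) : cylinder X -> cylinder (section y X).
Proof.
move=> [n nX]; exists n; apply: cylinder_section; exact: cylinder_beforeW (leqnSn n) _ nX.
Qed.

Definition nonvanishing k (E : nat -> set (nat -> T)) :=
  exists2 e : R, 0 < e & forall j, (e%:E <= stream_premeasure k (E j))%E.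

(** Otherwise the measures of the sections, which decrease with [j], tend to zero
    for every [y], and by dominated convergence so does their integral. *)
Lemma nonvanishing_section k (E : nat -> set (nat -> T)) :
  (forall j, cylinder (E j)) -> (forall j, E j.+1 `<=` E j) -> nonvanishing k E ->
  exists y, nonvanishing k.+1 (fun j => section y (E j)).
Proof.
move=> cE dE [e e0 eE]; apply: contrapT => noy.
pose f j y := stream_premeasure k.+1 (section y (E j)).
have cS j y : cylinder (section y (E j)) by exact: cylinder_sectionC.
have f_cvg y : f j y @[j --> \oo] --> 0%E.
  have decf : nonincreasing_seq (f ^~ y).
    by apply/nonincreasing_seqP => j; apply: le_stream_premeasure => // x; exact: dE.
  have -> : 0%E = ereal_inf (range (f ^~ y)).
    apply/eqP; rewrite eq_le; apply/andP; split.
      by apply: le_ereal_inf_tmp => _ [j _ <-]; exact: stream_premeasure_ge0.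
    apply/lee_addgt0Pr => c c0; rewrite add0e leNgt; apply/negP => cf.
    apply: noy; exists y; exists c => // j; apply: le_trans (ltW cf) _.
    by apply: ereal_inf_lbound; exists j.
  exact: ereal_nonincreasing_cvgn.
have [] := @dominated_convergence _ _ _ (mu k) _ measurableT f (cst 0%E) (cst 1%E).
- by move=> j; exact: measurable_section_premeasure.
- exact: measurable_cst.
- by apply: aeW => y _; exact: f_cvg.
- exact: finite_measure_integrable_cst.
- apply: aeW => y j _ /=; rewrite gee0_abs; last exact: stream_premeasure_ge0.
  exact: stream_premeasure_le1.
move=> _ _; rewrite integral_cst // mul0e => h.
have : (e%:E <= 0)%E.
  apply: (cvge_to_ge h); apply: nearW => j.
  by rewrite /= -stream_premeasure_section.
by rewrite lee_fin leNgt e0.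
Qed.

Definition pick_coord k (E : nat -> set (nat -> T)) : T :=
  xget point [set y | nonvanishing k.+1 (fun j => section y (E j))].

(** The sections that remain after [i] coordinates have been picked. *)
Fixpoint tail_sets k (E : nat -> set (nat -> T)) i : nat -> set (nat -> T) :=
  if i is i'.+1 then
    fun j => section (pick_coord (k + i') (tail_sets k E i')) (tail_sets k E i' j)
  else E.

(** Once the coordinates that decide [E j] are all picked, the section of [E j] is
    empty or everything; its measure is positive, so it is everything. *)
Lemma nonvanishing_inter k (E : nat -> set (nat -> T)) :
  (forall j, cylinder (E j)) -> (forall j, E j.+1 `<=` E j) -> nonvanishing k E ->
  exists x, forall j, E j x.
Proof.
move=> cE dE pE.
pose x i := pick_coord (k + i) (tail_sets k E i).
have tailP i : [/\ forall j, cylinder (tail_sets k E i j),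
    forall j, tail_sets k E i j.+1 `<=` tail_sets k E i j &
    nonvanishing (k + i) (tail_sets k E i)].
  elim: i => [|i [c1 d1 p1]]; first by rewrite addn0.
  split=> [j|j y|] /=; first exact: cylinder_sectionC.
    exact: d1.
  rewrite addnS; have := nonvanishing_section c1 d1 p1.
  by move=> /xgetPex; apply.
have tailE i j : E j x <-> tail_sets k E i j (fun l => x (i + l)%N).
  elim: i => [|i IHi] //; rewrite IHi /= /section /=.
  rewrite (_ : scons _ _ = fun l => x (i + l)%N) //.
  apply/funext => -[|l] /=; first by rewrite addn0.
  by rewrite addnS addSn.
have level m i j : cylinder_before m (E j) -> (i <= m)%N ->
    cylinder_before (m - i) (tail_sets k E i j).
  move=> mE; elim: i => [|i IHi] im; first by rewrite subn0.
  by apply: cylinder_section; rewrite subnSK //; apply: IHi; exact: ltnW.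
exists x => j; have [m mE] := cE j; apply/(tailE m).
have := level m m j mE (leqnn m); rewrite subnn => /cylinder_before0[tail0|-> //].
have [_ _ [e e0 /(_ j)]] := tailP m.
by rewrite tail0 stream_premeasure0 lee_fin leNgt e0.
Qed.

Lemma stream_premeasureU k (X Y : set (nat -> T)) : cylinder X -> cylinder Y ->
  [disjoint X & Y] ->
  stream_premeasure k (X `|` Y) = (stream_premeasure k X + stream_premeasure k Y)%E.
Proof.
move=> cX cY XY; have [n [nX nY]] := cylinder2 cX cY.
have [mX mY] := (measurable_cylinder_before nX, measurable_cylinder_before nY).
have nXY : cylinder_before n (X `|` Y).
  exact: (@measurableU _ (g_sigma_algebraType (@coordinate_sets d T n)) _ _ nX nY).
rewrite !(@stream_premeasureE _ n) // measureU //.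
exact/disj_set2P.
Qed.

(** The remainders of a disjoint union decrease and have no common point, so by
    [nonvanishing_inter] their measures tend to zero. *)
Lemma stream_premeasure_sigma_additive k :
  semi_sigma_additive (stream_premeasure k : set (stream T) -> \bar R).
Proof.
move=> F mF tF mU; pose U := \bigcup_i F i.
pose S n := \big[setU/set0]_(i < n) F i.
have cS n : cylinder (S n).
  by apply: (@bigsetU_measurable _ (stream T)) => i _; exact: mF.
pose G n := U `\` S n.
have cG n : cylinder (G n) by exact: (@measurableD _ (stream T) U (S n) mU (cS n)).
have sumE n : (\sum_(0 <= i < n) stream_premeasure k (F i))%E = stream_premeasure k (S n).
  elim: n => [|n IHn]; first by rewrite big_nil /S big_ord0 stream_premeasure0.
  rewrite big_nat_recr //= IHn /S big_ord_recr /= stream_premeasureU //.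
  - exact: cS.
  - exact: mF.
  apply/disj_set2P; rewrite -subset0 => x [].
  rewrite -bigcup_mkord => -[i /= i_n Fix] Fnx.
  have /trivIsetP /(_ i n I I) := tF; rewrite ltn_eqF // => /(_ isT) F0.
  by have : (F i `&` F n) x by []; rewrite F0.
have SU n : S n `<=` U by exact: bigsetU_bigcup.
have PU n : stream_premeasure k U = (stream_premeasure k (S n) + stream_premeasure k (G n))%E.
  rewrite -stream_premeasureU //; first by congr stream_premeasure; rewrite /G setDUK.
  by apply/disj_set2P; rewrite /G setDE setICA setICr setI0.
have Pfin X : cylinder X -> stream_premeasure k X \is a fin_num.
  move=> cX; rewrite ge0_fin_numE ?stream_premeasure_ge0 //.
  by apply: le_lt_trans (stream_premeasure_le1 _ cX) _; rewrite ltry.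
have dG n : G n.+1 `<=` G n.
  by apply: setDS; rewrite /S big_ord_recr /=; exact: subsetUl.
have G0 : stream_premeasure k (G n) @[n --> \oo] --> 0%E.
  have -> : 0%E = ereal_inf (range (fun n => stream_premeasure k (G n))).
    apply/eqP; rewrite eq_le; apply/andP; split.
      by apply: le_ereal_inf_tmp => _ [j _ <-]; exact: stream_premeasure_ge0.
    apply/lee_addgt0Pr => c c0; rewrite add0e leNgt; apply/negP => cf.
    have [|x xG] := @nonvanishing_inter k G cG dG.
      exists c => // j; apply: le_trans (ltW cf) _.
      by apply: ereal_inf_lbound; exists j.
    have [[i _ Fix] _] := xG 0%N.
    have [_] := xG i.+1; apply; rewrite /S -bigcup_mkord; exists i => //=.
  apply: ereal_nonincreasing_cvgn; apply/nonincreasing_seqP => j.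
  exact: le_stream_premeasure.
have -> : (fun n => \sum_(0 <= i < n) stream_premeasure k (F i))%E =
    (fun n => stream_premeasure k U - stream_premeasure k (G n))%E.
  by apply/funext => n; rewrite sumE (PU n) addeK // Pfin.
rewrite -[X in _ --> X]sube0; apply: cvgeB => //; last exact: cvg_cst.
by rewrite fin_num_adde_defr //; exact: Pfin.
Qed.

HB.instance Definition _ k := @isMeasure.Build _ (stream T) R (stream_premeasure k)
  (stream_premeasure0 k) (stream_premeasure_ge0 k) (@stream_premeasure_sigma_additive k).

Definition stream_law (k : nat) : set (stream_space T) -> \bar R :=
  measure_extension (stream_premeasure k).

HB.instance Definition _ k := Measure.on (stream_law k).

Lemma stream_lawE k (X : set (nat -> T)) : cylinder X ->
  stream_law k X = stream_premeasure k X.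
Proof. exact: (@measurable_mu_extE _ R (stream T) (stream_premeasure k) X). Qed.

Lemma stream_law_setT k : stream_law k setT = 1%E.
Proof.
by rewrite stream_lawE ?stream_premeasureT //; exact: (@measurableT _ (stream T)).
Qed.

HB.instance Definition _ k :=
  Measure_isProbability.Build _ _ _ (stream_law k) (stream_law_setT k).

Lemma stream_law_section k (X : set (nat -> T)) : cylinder X ->
  stream_law k X = (\int[mu k]_(y in [set: T]) stream_law k.+1 (section y X))%E.
Proof.
move=> cX; rewrite stream_lawE // stream_premeasure_section //.
by apply: eq_integral => y _; rewrite stream_lawE //; exact: cylinder_sectionC.
Qed.

End FiniteLaws.
Section Independence.
Context (d : measure_display) (T : measurableType d) (R : realType).
Context (mu : nat -> probability T R).

Definition shift_stream (n : nat) (x : nat -> T) : nat -> T := fun i => x (n + i)%N.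

Lemma cylinder_before_shift m n (X : set (nat -> T)) : cylinder_before m X ->
  cylinder_before (n + m) (shift_stream n @^-1` X).
Proof.
apply: (@preimage_generated_measurable _ (g_sigma_algebraType (@coordinate_sets d T (n + m)))).
move=> _ [i [B [im mB ->]]]; apply: (@cylinder_before_coord _ _ _ (n + i)) => //.
by rewrite ltn_add2l.
Qed.

Lemma cylinderI (X Y : set (nat -> T)) : cylinder X -> cylinder Y -> cylinder (X `&` Y).
Proof. exact: (@measurableI _ (stream T)). Qed.

Lemma measurable_section_stream_law k (X : set (nat -> T)) : cylinder X ->
  measurable_fun [set: T] (fun y => stream_law mu k (section y X)).
Proof.
move=> cX; have -> : (fun y => stream_law mu k (section y X)) =
    (fun y => stream_premeasure mu k (section y X)).
  by apply/funext => y; rewrite stream_lawE //; exact: cylinder_sectionC.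
exact: measurable_section_premeasure.
Qed.

Lemma cylinder_beforeT n : cylinder_before n [set: nat -> T].
Proof. exact: (@measurableT _ (g_sigma_algebraType (@coordinate_sets d T n))). Qed.

Lemma cylinder_before_box m (B : nat -> set T) : (forall i, measurable (B i)) ->
  cylinder_before m [set x | forall i, (i < m)%N -> B i (x i)].
Proof.
move=> mB; rewrite (_ : [set x | _] = \bigcap_(i in `I_m) (fun x => x i) @^-1` B i) //.
apply: (@fin_bigcap_measurable _ (g_sigma_algebraType (@coordinate_sets d T m))).
  exact: finite_II.
by move=> i im; exact: cylinder_before_coord.
Qed.

(** Peeling off the first coordinate of both events reduces [n] by one. *)
Lemma stream_law_indep n k (H G : set (nat -> T)) : cylinder_before n H -> cylinder G ->
  stream_law mu k (H `&` shift_stream n @^-1` G) =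
  (stream_law mu k H * stream_law mu (k + n) G)%E.
Proof.
elim: n k H => [|n IHn] k H nH cG.
  rewrite (_ : shift_stream 0 @^-1` G = G) //.
  have [->|->] := cylinder_before0 nH; first by rewrite set0I !measure0 mul0e.
  by rewrite setTI stream_law_setT mul1e addn0.
have [m mG] := cG.
have cH : cylinder H by exists n.+1.
have cS : cylinder (shift_stream n.+1 @^-1` G).
  by exists (n.+1 + m)%N; exact: cylinder_before_shift.
rewrite stream_law_section; last exact: cylinderI.
rewrite (stream_law_section mu k cH) -ge0_integralZr //; first last.
- exact: measurable_section_stream_law.
apply: eq_integral => y _; rewrite -addSnnS -IHn //.
exact: cylinder_section.
Qed.

Lemma stream_law_box m k (B : nat -> set T) : (forall i, measurable (B i)) ->
  stream_law mu k [set x | forall i, (i < m)%N -> B i (x i)] =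
  (\prod_(i < m) mu (k + i)%N (B i))%E.
Proof.
elim: m k B => [|m IHm] k B mB.
  rewrite big_ord0 -(stream_law_setT mu k); congr stream_law.
  by apply/seteqP; split.
rewrite stream_law_section; last by exists m.+1; exact: cylinder_before_box.
rewrite big_ord_recl /= addn0.
under eq_bigr => i _ do rewrite /bump /= add1n addnS -addSn.
rewrite -(IHm k.+1 (fun i => B i.+1)) //.
rewrite -[mu k _](_ : (\int[mu k]_y (\1_(B 0%N) y)%:E = _)%E); last first.
  by rewrite integral_indic // setIT.
rewrite -ge0_integralZr //; last first.
  by apply/measurable_EFinP.
apply: eq_integral => y _; rewrite indicE; case: (boolP (y \in B 0%N)) => By.
  rewrite mul1e; congr stream_law; apply/seteqP; split=> x /=.
    by move=> h i im; exact: (h i.+1).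
  by move=> h [|i] im /=; [rewrite inE in By|exact: h].
rewrite mul0e -(measure0 (stream_law mu k.+1)); congr stream_law.
apply/seteqP; split => x //= /(_ 0%N isT) /=.
by rewrite notin_setE in By.
Qed.

Lemma stream_law_coord k i (B : set T) : measurable B ->
  stream_law mu k [set x | B (x i)] = mu (k + i)%N B.
Proof.
move=> mB.
have -> : [set x : nat -> T | B (x i)] =
    setT `&` shift_stream i @^-1` [set x | forall j, (j < 1)%N -> B (x j)].
  rewrite setTI; apply/seteqP; split=> x /= h; last first.
    by have := h 0%N isT; rewrite /shift_stream addn0.
  by move=> [|j] //; rewrite /shift_stream addn0.
rewrite stream_law_indep; first last.
- by exists 1%N; apply: (@cylinder_before_box 1 (fun=> B)).
- exact: cylinder_beforeT.
rewrite stream_law_setT mul1e (@stream_law_box 1 (k + i) (fun=> B)) //.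
by rewrite big_ord_recl big_ord0 mule1 addn0.
Qed.

End Independence.
(** * Integrals over conditional laws, cases and series *)

Section ConditionalLaw.
Context (dO dY : measure_display) (Omega : measurableType dO) (Y : measurableType dY).
Context (R : realType) (P : probability Omega R) (nu : probability Y R).
Context (X : Omega -> Y) (H : set Omega).
Hypothesis mX : measurable_fun [set: Omega] X.
Hypothesis mH : measurable H.
Hypothesis XH : forall B, measurable B -> P (H `&` X @^-1` B) = (P H * nu B)%E.

(** The hypothesis says that [X] pushes the restriction of [P] to [H] to [P H * nu];
    the identity is the corresponding change of variables. *)
Lemma ge0_integral_cond_law (f : Y -> \bar R) : measurable_fun [set: Y] f ->
  (forall y, (0 <= f y)%E) ->
  (\int[P]_(o in H) f (X o) = P H * \int[nu]_(y in [set: Y]) f y)%E.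
Proof.
move=> mf f0.
have PHfin : P H \is a fin_num by exact: fin_num_measure.
pose c : {nonneg R} := NngNum (fine_ge0 (measure_ge0 P H)).
rewrite -[P H in RHS]fineK // -[fine (P H)]/(c%:num) -ge0_integral_mscale //.
rewrite -(@eq_measure_integral _ _ _ _ _ (pushforward (mrestr P mH) X)); last first.
  move=> B mB _; transitivity (P (X @^-1` B `&` H)); first by [].
  by rewrite setIC XH //= /mscale /= fineK.
rewrite ge0_integral_pushforward // preimage_setT.
rewrite (@ge0_negligible_integral _ _ _ _ _ (~` H)) //; first last.
- by rewrite -(measure0 P) -(setICl H).
- by move=> o _; exact: f0.
- exact: measurableT_comp.
- exact: measurableC.
rewrite setTD setCK; apply: eq_measure_integral => B mB BH.
by rewrite -{1}(setIidl BH).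
Qed.

Lemma integral_cond_law (f : Y -> \bar R) : nu.-integrable [set: Y] f ->
  (\int[P]_(o in H) f (X o) = P H * \int[nu]_(y in [set: Y]) f y)%E.
Proof.
move=> fint; have mf := measurable_int nu fint.
have posint := integrable_fin_num measurableT (integrable_funepos measurableT fint).
rewrite integralE [in RHS]integralE muleBr ?fin_num_measure ?fin_num_adde_defr //.
have mpos : measurable_fun [set: Y] (f^\+)%E by exact: measurable_funepos.
have mneg : measurable_fun [set: Y] (f^\-)%E by exact: measurable_funeneg.
congr (_ - _)%E;
  [rewrite -(ge0_integral_cond_law mpos) //|rewrite -(ge0_integral_cond_law mneg) //];
  by apply: eq_integral => o _; rewrite ?funeposE ?funenegE.
Qed.

Lemma integrable_cond_law (f : Y -> \bar R) : nu.-integrable [set: Y] f ->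
  P.-integrable H (f \o X).
Proof.
move=> /integrableP[mf fint]; apply/integrableP; split.
  by apply: measurable_funTS; exact: measurableT_comp.
rewrite /= (ge0_integral_cond_law (f := fun y => `|f y|%E)) //; last first.
  exact: measurableT_comp.
rewrite lte_mul_pinfty //.
by rewrite ge0_fin_numE //; apply: le_lt_trans (probability_le1 _ mH) _; rewrite ltry.
Qed.

End ConditionalLaw.

Section FiniteCases.
Context (dO : measure_display) (Omega : measurableType dO) (F : finType) (R : realType).
Context (X : Omega -> F).
Hypothesis mX : forall x, measurable (X @^-1` [set x]).

Lemma fin_caseE (h : F -> Omega -> R) o :
  h (X o) o = \sum_(x : F) \1_(X @^-1` [set x]) o * h x o.
Proof.
rewrite (bigD1 (X o)) //= big1 => [|x xo]; rewrite indicE.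
  by rewrite mem_set //= mul1r addr0.
by rewrite memNset ?mul0r //= => xE; rewrite xE eqxx in xo.
Qed.

Lemma measurable_fin_case (h : F -> Omega -> R) :
  (forall x, measurable_fun [set: Omega] (h x)) ->
  measurable_fun [set: Omega] (fun o => h (X o) o).
Proof.
move=> mh; have -> : (fun o => h (X o) o) =
    (fun o => \sum_(x : F) \1_(X @^-1` [set x]) o * h x o).
  by apply/funext => o; exact: fin_caseE.
by apply: measurable_sum => x; apply: measurable_funM.
Qed.

Context (P : probability Omega R).

(** The random variable [X] splits the space into finitely many measurable pieces. *)
Lemma integrable_fin_case (h : F -> Omega -> R) :
  (forall x, P.-integrable (X @^-1` [set x]) (EFin \o h x)) ->
  P.-integrable [set: Omega] (fun o => (h (X o) o)%:E) /\
  (\int[P]_(o in [set: Omega]) (h (X o) o)%:E =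
   \sum_(x : F) \int[P]_(o in X @^-1` [set x]) (h x o)%:E)%E.
Proof.
move=> hint.
have hE : (fun o => (h (X o) o)%:E) =
    (fun o => \sum_(x : F) ((EFin \o h x) \_ (X @^-1` [set x])) o)%E.
  apply/funext => o; rewrite fin_caseE -sumEFin; apply: eq_bigr => x _.
  rewrite patchE indicE; case: ifPn => _; first by rewrite mul1r.
  by rewrite mul0r.
have hint' x : P.-integrable [set: Omega] ((EFin \o h x) \_ (X @^-1` [set x])).
  by rewrite -integrable_mkcond.
split; first by rewrite hE; exact: integrable_sum.
rewrite hE integral_sum //; apply: eq_bigr => x _.
by rewrite -integral_mkcond.
Qed.

End FiniteCases.
Section DominatedSeries.
Context (dO : measure_display) (Omega : measurableType dO) (R : realType).

Lemma cvg_limn_einf_esup (u : (\bar R)^nat) : limn_einf u = limn_esup u -> cvgn u.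
Proof.
move=> ul; apply/cvg_ex; exists (limn_esup u).
apply: (@squeeze_cvge _ _ _ _ (einfs u) u (esups u)).
- apply: nearW => n; apply/andP; split.
    by apply: ereal_inf_lbound; exists n => /=.
  by apply: ereal_sup_ubound; exists n => /=.
- by rewrite -ul limn_einf_lim; exact: is_cvg_einfs.
- by rewrite limn_esup_lim; exact: is_cvg_esups.
Qed.

(** A divergent sequence has the default value as its limit, so the set where the
    upper and the lower limits agree enters the proof. *)
Lemma measurable_limn (f : nat -> Omega -> \bar R) :
  (forall n, measurable_fun [set: Omega] (f n)) ->
  measurable_fun [set: Omega] (fun o => limn (f ^~ o)).
Proof.
move=> mf.
have -> : (fun o => limn (f ^~ o)) = (fun o =>
    if limn_einf (f ^~ o) == limn_esup (f ^~ o) then limn_esup (f ^~ o) else point).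
  apply/funext => w; case: eqP => [/cvg_limn_einf_esup/is_cvg_limn_esupE -> //|ul].
  apply: dvgP => fcvg; apply: ul.
  by rewrite is_cvg_limn_einfE // is_cvg_limn_esupE.
have msup : measurable_fun [set: Omega] (fun o => limn_esup (f ^~ o)).
  exact: measurable_fun_limn_esup.
apply: measurable_fun_ifT => //; apply: measurable_fun_eqe => //.
rewrite (_ : (fun o => _) = (fun o => - limn_esup (fun n => - f n o))%E) //.
apply: measurableT_comp => //; apply: measurable_fun_limn_esup => n.
exact: measurableT_comp.
Qed.

Lemma cvg_abs_series (a : nat -> R) : (\sum_(0 <= t <oo) `|a t|%:E < +oo)%E ->
  cvgn (fun n => \sum_(0 <= t < n) (a t)%:E)%E.
Proof.
move=> aoo.
have abs0 t : (0 <= `|a t|%:E)%E by rewrite lee_fin.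
have : cvgn (series a).
  apply: normed_cvg; apply/cvg_ex; exists (fine (\sum_(0 <= t <oo) `|a t|%:E)%E).
  have -> : [normed series a] = fine \o (fun n => \sum_(0 <= t < n) `|a t|%:E)%E.
    by apply/funext => n /=; rewrite sumEFin.
  apply: fine_cvg; rewrite fineK.
    by apply: is_cvg_nneseries => t _ _; exact: abs0.
  by rewrite ge0_fin_numE //; apply: nneseries_ge0 => t _ _; exact: abs0.
move=> /cvg_ex[l al]; apply/cvg_ex; exists l%:E.
have -> : (fun n => \sum_(0 <= t < n) (a t)%:E)%E = EFin \o series a.
  by apply/funext => n; rewrite sumEFin.
by apply: cvg_EFin => //; exact: nearW.
Qed.

Context (P : probability Omega R) (f : nat -> Omega -> R).
Hypothesis mf : forall t, measurable_fun [set: Omega] (f t).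
Hypothesis fsum : (\int[P]_(o in [set: Omega]) \sum_(0 <= t <oo) `|f t o|%:E < +oo)%E.

Let g o := (\sum_(0 <= t <oo) `|f t o|%:E)%E.

Let mg : measurable_fun [set: Omega] g.
Proof.
apply: ge0_emeasurable_sum => [t o _ _|t _]; first by rewrite lee_fin.
by apply/measurable_EFinP; exact: measurableT_comp.
Qed.

Let g_ge0 o : (0 <= g o)%E.
Proof. by apply: nneseries_ge0 => t _ _; rewrite lee_fin. Qed.

Let g_int : P.-integrable [set: Omega] g.
Proof.
apply/integrableP; split => //.
by under eq_integral do rewrite gee0_abs //.
Qed.

Let partial_le_g n o : (\sum_(0 <= t < n) `|f t o|%:E <= g o)%E.
Proof.
by apply: nneseries_lim_ge => t _ _; rewrite lee_fin.
Qed.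

Lemma abs_series_integrable t : P.-integrable [set: Omega] (EFin \o f t).
Proof.
apply: le_integrable g_int => //; first exact/measurable_EFinP.
move=> o _ /=; rewrite (gee0_abs (g_ge0 o)); apply: le_trans (partial_le_g t.+1 o).
by rewrite big_nat_recr //= leeDr // sume_ge0 // => i _; rewrite lee_fin.
Qed.

(** The partial sums are dominated by the integrable sum of the absolute values. *)
Lemma dominated_series :
  (fun n => \sum_(0 <= t < n) \int[P]_(o in [set: Omega]) (f t o)%:E)%E @ \oo -->
  (\int[P]_(o in [set: Omega]) \sum_(0 <= t <oo) (f t o)%:E)%E.
Proof.
pose F n o := (\sum_(0 <= t < n) (f t o)%:E)%E.
have FE n : (\int[P]_(o in [set: Omega]) F n o =
    \sum_(0 <= t < n) \int[P]_(o in [set: Omega]) (f t o)%:E)%E.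
  by apply: integral_sum => // t; exact: abs_series_integrable.
rewrite -(funext FE).
have mF n : measurable_fun [set: Omega] (F n).
  apply: emeasurable_sum => t; exact/measurable_EFinP.
have [] := @dominated_convergence _ _ _ P _ measurableT F
  (fun o => \sum_(0 <= t <oo) (f t o)%:E)%E g mF (measurable_limn mF).
- apply: filterS (integrable_ae measurableT g_int) => o gfin _.
  apply: cvg_abs_series; have := gfin I; rewrite ge0_fin_numE //.
- exact: g_int.
- apply: aeW => o n _; apply: le_trans (partial_le_g n o).
  by apply: le_trans (lee_abs_sum _ _ _) _.
by [].
Qed.

End DominatedSeries.
(** * The telescoping estimate for a realization of the process *)

Section ProcessLaws.
Context (R : realType) (S A : finType) (M : mdp R S A).
Context (d : nat -> S -> noise_law R A) (psi : nat -> S -> #|A|.-tuple R -> A).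
Context (dO : measure_display) (Omega : measurableType dO) (P : probability Omega R).
Context (noise : nat -> S -> Omega -> #|A|.-tuple R) (state : nat -> Omega -> S) (s0 : S).
Hypothesis A0 : (0 < #|A|)%N.
Hypothesis mpsi : forall t s a, measurable (psi t s @^-1` [set a]).
Hypothesis proc : ds_process M d psi P noise state s0.
Local Notation act := (action psi noise state).
Local Notation q := (trans M).
Local Notation gamma := (discount M).

Definition state_prob n s : R := fine (P (state n @^-1` [set s])).

Lemma state_probE n s : P (state n @^-1` [set s]) = (state_prob n s)%:E.
Proof. by rewrite fineK // fin_num_measure //; exact: state_measurable proc _ _. Qed.

Lemma state_prob_ge0 n s : 0 <= state_prob n s.
Proof. exact/fine_ge0/measure_ge0. Qed.

Definition state_mean n (V : S -> R) : R := \sum_s state_prob n s * V s.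

(** The current state belongs to the history before the noise is drawn. *)
Lemma noise_given_state n s B : measurable B ->
  P (state n @^-1` [set s] `&` noise n s @^-1` B) =
  (P (state n @^-1` [set s]) * d n s B)%E.
Proof.
move=> mB; pose B' s' := if s' == s then B else setT.
have mB' s' : measurable (B' s') by rewrite /B'; case: ifP.
have hist : history noise state n n.+1 (state n @^-1` [set s]).
  by apply: sub_sigma_algebra; right; exists n, s.
have := noise_cond_law proc hist mB'.
rewrite (bigD1 s) //= /B' eqxx big1 ?mule1 => [<-|s' /negbTE ->]; last first.
  exact: probability_setT.
congr (P (_ `&` _)); apply/seteqP; split => o /= h; last by have := h s; rewrite eqxx.
by move=> s'; case: eqP => [->|].
Qed.

Lemma measurable_action n a : measurable (act n @^-1` [set a]).
Proof.
rewrite (_ : _ @^-1` _ = \bigcup_(s in [set: S])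
    (state n @^-1` [set s] `&` noise n s @^-1` (psi n s @^-1` [set a]))).
  apply: fin_bigcup_measurable => [|s _]; first exact: finite_finset.
  apply: measurableI; first exact: state_measurable proc _ _.
  by rewrite -[_ @^-1` _]setTI; apply: (noise_measurable proc).
by apply/seteqP; split => [w h|w [s _ [/= <- ?]]] //; exists (state n w).
Qed.

Definition state_action n o : S * A := (state n o, act n o).

Lemma measurable_state_action n x : measurable (state_action n @^-1` [set x]).
Proof.
case: x => s a; rewrite (_ : _ @^-1` _ = state n @^-1` [set s] `&` act n @^-1` [set a]).
  by apply: measurableI; [exact: state_measurable proc _ _|exact: measurable_action].
apply/seteqP; split => w; first by rewrite /state_action => -[sE aE]; split.
by move=> [sE aE]; rewrite /= /state_action sE aE.
Qed.

Definition state_action_prob n x : R := fine (P (state_action n @^-1` [set x])).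

Lemma state_action_probE n x :
  P (state_action n @^-1` [set x]) = (state_action_prob n x)%:E.
Proof. by rewrite fineK // fin_num_measure //; exact: measurable_state_action. Qed.

(** The conditional law of the next state, summed over the present state and action. *)
Lemma state_prob_next n y :
  state_prob n.+1 y = \sum_(x : S * A) q y x.1 x.2 * state_action_prob n x.
Proof.
have mB := state_measurable proc n.+1 y; set B := state n.+1 @^-1` [set y] in mB.
have Bint x : P.-integrable (state_action n @^-1` [set x]) (EFin \o \1_B).
  by apply: (integrableS measurableT) => //;
    [exact: measurable_state_action|exact: integrable_indic].
have [_] := integrable_fin_case (@measurable_state_action n) Bint.
rewrite integral_indic // setIT => PB; apply: EFin_inj.
rewrite -state_probE; apply: etrans PB _.
rewrite -sumEFin; apply: eq_bigr => -[x a] _ /=.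
rewrite integral_indic //; last exact: measurable_state_action.
rewrite EFinM -state_action_probE.
have hist : history noise state n.+1 n.+1 setT by exact: (@measurableT _ (g_sigma_algebraType _)).
have := state_cond_law proc x a y hist; rewrite !setTI => E.
transitivity (P [set o | [/\ state n o = x, act n o = a & state n.+1 o = y]]).
  congr (P _); apply/seteqP; split => w; first by move=> [yE [sE aE]].
  by move=> [sE aE yE]; split => //; rewrite /= /state_action sE aE.
rewrite E; congr (_ * P _)%E; apply/seteqP; split => w.
  by move=> [sE aE]; rewrite /= /state_action sE aE.
by move=> [sE aE].
Qed.

Lemma noise_function_mean n (g : S -> #|A|.-tuple R -> R) :
  (forall s, (d n s).-integrable [set: #|A|.-tuple R] (fun e => (g s e)%:E)) ->
  P.-integrable [set: Omega] (fun o => (g (state n o) (noise n (state n o) o))%:E) /\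
  (\int[P]_(o in [set: Omega]) (g (state n o) (noise n (state n o) o))%:E =
   \sum_s (state_prob n s)%:E *
     \int[d n s]_(e in [set: #|A|.-tuple R]) (g s e)%:E)%E.
Proof.
move=> gint.
have mS := state_measurable proc n.
have mN := noise_measurable proc n.
have hint s : P.-integrable (state n @^-1` [set s])
    (EFin \o (fun o => g s (noise n s o))).
  exact: (integrable_cond_law (mN s) (mS s) (@noise_given_state n s) (gint s)).
have [int ->] := integrable_fin_case mS hint; split=> //.
apply: eq_bigr => s _; rewrite -state_probE.
exact: (integral_cond_law (mN s) (mS s) (@noise_given_state n s) (gint s)).
Qed.

Lemma noisy_max_mean n (u : S -> A -> R) : (forall s, noise_integrable (d n s)) ->
  P.-integrable [set: Omega]
    (fun o => (noisy_max (u (state n o)) (noise n (state n o) o))%:E) /\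
  (\int[P]_(o in [set: Omega]) (noisy_max (u (state n o)) (noise n (state n o) o))%:E =
   (state_mean n (fun s => fine (emax (d n s) (u s))))%:E)%E.
Proof.
move=> dint.
have [|int ->] := @noise_function_mean n (fun s => noisy_max (u s)).
  by move=> s; exact: integrable_noisy_max.
split=> //; rewrite -sumEFin; apply: eq_bigr => s _.
by rewrite EFinM (fineK (emax_fin A0 _ (dint s))).
Qed.

(** The part of the weight [weight M V s a] that comes from the next state. *)
Definition continuation (V : S -> R) (x : S * A) : R :=
  gamma * \sum_(y : S) q y x.1 x.2 * V y.

Lemma continuation_mean n (V : S -> R) :
  P.-integrable [set: Omega] (fun o => (continuation V (state_action n o))%:E) /\
  (\int[P]_(o in [set: Omega]) (continuation V (state_action n o))%:E =
   (gamma * state_mean n.+1 V)%:E)%E.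
Proof.
have mX := @measurable_state_action n.
have Qint x : P.-integrable (state_action n @^-1` [set x]) (EFin \o (fun=> continuation V x)).
  exact: finite_measure_integrable_cst.
have [int ->] := integrable_fin_case mX Qint; split=> //.
transitivity (\sum_(x : S * A) (continuation V x * state_action_prob n x)%:E)%E.
  apply: eq_bigr => x _; rewrite (integral_cst P (mX x) (continuation V x)%:E) /=.
  by rewrite EFinM state_action_probE.
rewrite sumEFin; congr EFin.
rewrite /state_mean; under [in RHS]eq_bigr do rewrite state_prob_next mulr_suml.
rewrite exchange_big mulr_sumr; apply: eq_bigr => x _ /=.
rewrite /continuation -mulrA mulr_suml; congr (_ * _); apply: eq_bigr => y _.
by rewrite mulrAC.
Qed.

Local Notation stage := (stage_reward M psi noise state).

Lemma measurable_stage n : measurable_fun [set: Omega] (stage n).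
Proof.
apply: (measurable_fin_case (@measurable_state_action n)
  (h := fun x o => gamma ^+ n * (reward M x.2 x.1 + noise_at (noise n x.1 o) x.2))) => x.
apply: measurable_funM => //; apply: measurable_funD => //.
exact: measurableT_comp (@measurable_noise_at R A x.2) (noise_measurable proc n x.1).
Qed.

Lemma stageE V n o : stage n o + gamma ^+ n * continuation V (state_action n o) =
  gamma ^+ n * (weight M V (state n o) (act n o)
                + noise_at (noise n (state n o) o) (act n o)).
Proof. by rewrite -mulrDr; congr (_ * _); rewrite addrAC. Qed.

(** The chosen action does at most as well as the best one for the weights of [V]. *)
Lemma stage_le V n o : stage n o + gamma ^+ n * continuation V (state_action n o) <=
  gamma ^+ n * noisy_max (weight M V (state n o)) (noise n (state n o) o).
Proof.
rewrite stageE ler_wpM2l ?exprn_ge0 ?discount_ge0 //.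
exact: le_fmax (fun a => weight M V (state n o) a + noise_at _ a) _.
Qed.

Lemma stage_greedy V n o : (forall s, argmax_rule (weight M V s) (psi n s)) ->
  stage n o + gamma ^+ n * continuation V (state_action n o) =
  gamma ^+ n * noisy_max (weight M V (state n o)) (noise n (state n o) o).
Proof. by move=> greedy; rewrite stageE (argmax_ruleE A0 _ (greedy _)). Qed.

Lemma discounted_mean n (f : Omega -> R) c :
  P.-integrable [set: Omega] (EFin \o f) /\ (\int[P]_(o in [set: Omega]) (f o)%:E = c%:E)%E ->
  P.-integrable [set: Omega] (EFin \o (fun o => gamma ^+ n * f o)) /\
  (\int[P]_(o in [set: Omega]) (gamma ^+ n * f o)%:E = (gamma ^+ n * c)%:E)%E.
Proof.
move=> [fint fE]; split; first exact: (integrableZl measurableT _ fint).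
by under eq_integral do rewrite EFinM; rewrite integralZl // fE.
Qed.

(** One step of the telescoping sum of [expected_total_reward_le]. *)
Lemma stage_mean_le n V : P.-integrable [set: Omega] (EFin \o stage n) ->
  (forall s, noise_integrable (d n s)) ->
  (\int[P]_(o in [set: Omega]) (stage n o)%:E + (gamma ^+ n.+1 * state_mean n.+1 V)%:E <=
   (gamma ^+ n * state_mean n (fun s => fine (emax (d n s) (weight M V s))))%:E)%E.
Proof.
move=> sint dint.
have [int1 <-] := discounted_mean n (noisy_max_mean (weight M V) dint).
have [int2] := discounted_mean n (continuation_mean n V).
rewrite mulrA -exprSr => <-; rewrite -integralD //.
apply: le_integral => //; first exact: integrableD.
by move=> o _; rewrite -EFinD lee_fin; exact: stage_le.
Qed.

(** For argmax rules the step is an equality; moreover the reward is then a difference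
    of integrable terms, although the noise of a single action need not be
    integrable. *)
Lemma stage_mean_greedy n V : (forall s, noise_integrable (d n s)) ->
  (forall s, argmax_rule (weight M V s) (psi n s)) ->
  P.-integrable [set: Omega] (EFin \o stage n) /\
  (\int[P]_(o in [set: Omega]) (stage n o)%:E + (gamma ^+ n.+1 * state_mean n.+1 V)%:E =
   (gamma ^+ n * state_mean n (fun s => fine (emax (d n s) (weight M V s))))%:E)%E.
Proof.
move=> dint greedy.
have [int1 <-] := discounted_mean n (noisy_max_mean (weight M V) dint).
have [int2] := discounted_mean n (continuation_mean n V).
have sint : P.-integrable [set: Omega] (EFin \o stage n).
  apply: eq_integrable (integrableB measurableT int1 int2) => // o _.
  by rewrite /= -EFinB -(stage_greedy _ greedy) addrK.
rewrite mulrA -exprSr => <-; split => //; rewrite -integralD //.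
by apply: eq_integral => o _; rewrite -EFinD (stage_greedy _ greedy).
Qed.

Lemma state_prob_sum n : \sum_s state_prob n s = 1.
Proof.
have mS := state_measurable proc n.
have cint s : P.-integrable (state n @^-1` [set s]) (EFin \o (fun=> 1)).
  exact: finite_measure_integrable_cst.
have [_] := integrable_fin_case mS cint.
rewrite (integral_cst P measurableT 1) /= probability_setT mule1 => h.
apply: EFin_inj; rewrite h -sumEFin; apply: eq_bigr => s _.
by rewrite -state_probE (integral_cst P (mS s) 1) mul1e.
Qed.

Lemma state_mean_init V : state_mean 0 V = V s0.
Proof.
have p0 s : state_prob 0 s = (s == s0)%:R.
  rewrite /state_prob; have [->|ss0] := eqVneq s s0.
    rewrite (_ : _ @^-1` _ = setT) ?probability_setT //.
    by apply/seteqP; split => // o _ /=; exact: (state_init proc).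
  rewrite (_ : _ @^-1` _ = set0) ?measure0 //; apply/seteqP; split => // o /=.
  by rewrite (state_init proc) => s0s; rewrite s0s eqxx in ss0.
rewrite /state_mean (bigD1 s0) //= big1 ?addr0 => [|s ss0]; rewrite p0.
  by rewrite eqxx mul1r.
by rewrite (negbTE ss0) mul0r.
Qed.

Lemma le_state_mean n V V' : (forall s, V s <= V' s) -> state_mean n V <= state_mean n V'.
Proof. by move=> VV; apply: ler_sum => s _; rewrite ler_wpM2l ?state_prob_ge0. Qed.

Lemma state_mean_bound n V : `|state_mean n V| <= sup_norm V.
Proof.
apply: le_trans (ler_norm_sum _ _ _) _.
rewrite -[leRHS]mul1r -(state_prob_sum n) mulr_suml; apply: ler_sum => s _.
by rewrite normrM (ger0_norm (state_prob_ge0 n s)) ler_wpM2l ?state_prob_ge0 ?le_sup_norm.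
Qed.

Hypothesis gamma1 : gamma < 1.

(** The discounted value of the state at time [n], which is left over by the
    telescoping sum, vanishes in the limit. *)
Lemma discounted_state_mean_cvg V (c : R) :
  (c - gamma ^+ n * state_mean n V)%:E @[n --> \oo] --> c%:E.
Proof.
apply: cvg_EFin; first exact: nearW.
rewrite -[X in _ --> X]subr0; apply: cvgB; first exact: cvg_cst.
apply: (@squeeze_cvgr _ _ _ _ (fun n => - (gamma ^+ n * sup_norm V))
  (fun n => gamma ^+ n * sup_norm V)).
- apply: nearW => n; rewrite -ler_norml normrM ger0_norm ?exprn_ge0 ?discount_ge0 //.
  by rewrite ler_wpM2l ?exprn_ge0 ?discount_ge0 ?state_mean_bound.
all: have g0 : gamma ^+ n * sup_norm V @[n --> \oo] --> 0 * sup_norm V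
  by apply: cvgMl; apply: cvg_expr; rewrite ger0_norm ?discount_ge0.
- by rewrite -oppr0 -(mul0r (sup_norm V)); exact: cvgN.
- by rewrite -[X in _ --> X](mul0r (sup_norm V)).
Qed.

Hypothesis dint : forall t s, noise_integrable (d t s).
Lemma sum_geometric_le (K : R) n : 0 <= K ->
  \sum_(0 <= t < n) gamma ^+ t * K <= K / (1 - gamma).
Proof.
move=> K0; set L := K / (1 - gamma).
have g1 : 0 < 1 - gamma by rewrite subr_gt0.
have KE : K = L * (1 - gamma) by rewrite /L divfK // gt_eqF.
have -> : \sum_(0 <= t < n) gamma ^+ t * K = L * (1 - gamma ^+ n).
  elim: n => [|n IHn]; first by rewrite big_nil expr0 subrr mulr0.
  by rewrite big_nat_recr //= IHn exprS KE; ring.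
rewrite ler_piMr ?divr_ge0 ?(ltW g1) // gerBl exprn_ge0 // discount_ge0 //.
Qed.

(** The reward at time [t] is [gamma ^+ t] times a quantity whose mean absolute
    value is bounded uniformly in [t]. *)
Lemma greedy_total_reward_integrable V (K : R) :
  (forall t s, argmax_rule (weight M V s) (psi t s)) ->
  (forall t s, (\int[d t s]_(e in [set: #|A|.-tuple R])
     (`|noisy_max (weight M V s) e| + \sum_x `|continuation V x|)%:E <= K%:E)%E) ->
  total_reward_integrable M psi P noise state.
Proof.
move=> greedy bound; pose C := \sum_x `|continuation V x|.
pose g s e := `|noisy_max (weight M V s) e| + C.
have gint t s : (d t s).-integrable [set: #|A|.-tuple R] (fun e => (g s e)%:E).
  apply: (@integrableD _ _ _ (d t s) _ measurableT
    (fun e => `|(noisy_max (weight M V s) e)%:E|%E) (EFin \o cst C)).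
    exact/integrable_abse/integrable_noisy_max.
  exact: finite_measure_integrable_cst.
have K0 : 0 <= K.
  rewrite -lee_fin; apply: le_trans (bound 0%N s0); apply: integral_ge0 => e _.
  by rewrite lee_fin addr_ge0 // sumr_ge0.
have stage_bound t : (\int[P]_(o in [set: Omega]) `|stage t o|%:E <= (gamma ^+ t * K)%:E)%E.
  have [int gE] := noise_function_mean (gint t).
  apply: (@le_trans _ _ (\int[P]_(o in [set: Omega])
      ((gamma ^+ t)%:E * (g (state t o) (noise t (state t o) o))%:E))%E).
    have [sint _] := stage_mean_greedy (dint t) (greedy t).
    apply: le_integral => //.
    - exact: (integrable_abse sint).
    - exact: integrableZl.
    - move=> o _; rewrite lee_fin -(addrK (gamma ^+ t * continuation V (state_action t o)) (stage t o)).
      rewrite (stage_greedy _ (greedy t)) -mulrBr normrM ger0_norm ?exprn_ge0 ?discount_ge0 //.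
      rewrite ler_wpM2l ?exprn_ge0 ?discount_ge0 // (le_trans (ler_normB _ _)) // lerD2l.
      by rewrite /C (bigD1 (state_action t o)) //= lerDl sumr_ge0.
  rewrite integralZl // gE EFinM lee_wpmul2l ?lee_fin ?exprn_ge0 ?discount_ge0 //.
  rewrite -[leRHS]mul1e -(state_prob_sum t) -sumEFin ge0_sume_distrl; last first.
    by move=> s _; rewrite lee_fin state_prob_ge0.
  by apply: lee_sum => s _; rewrite lee_wpmul2l ?lee_fin ?state_prob_ge0.
rewrite /total_reward_integrable integral_nneseries //; last first.
  by move=> t; apply/measurable_EFinP/measurableT_comp => //; exact: measurable_stage.
apply: (@le_lt_trans _ _ (K / (1 - gamma))%:E); last by rewrite ltry.
apply: lime_le.
  by apply: is_cvg_nneseries => t _ _; apply: integral_ge0 => o _; rewrite lee_fin.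
apply: nearW => n; apply: (@le_trans _ _ (\sum_(0 <= t < n) (gamma ^+ t * K)%:E)%E).
  by apply: lee_sum => t _; exact: stage_bound.
by rewrite sumEFin lee_fin sum_geometric_le.
Qed.

Hypothesis total_int : total_reward_integrable M psi P noise state.

Lemma expected_total_reward_cvg :
  (fun n => \sum_(0 <= t < n) \int[P]_(o in [set: Omega]) (stage t o)%:E)%E @ \oo -->
  expected_total_reward M psi P noise state.
Proof. exact: (dominated_series measurable_stage total_int). Qed.

Lemma stage_integrable t : P.-integrable [set: Omega] (EFin \o stage t).
Proof. exact: (abs_series_integrable measurable_stage total_int). Qed.

Lemma stage_mean_finite t :
  (\int[P]_(o in [set: Omega]) (stage t o)%:E =
   (fine (\int[P]_(o in [set: Omega]) (stage t o)%:E))%:E)%E.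
Proof. by rewrite fineK // integrable_fin_num //; exact: stage_integrable. Qed.

Lemma expected_total_reward_le V :
  (forall t s, fine (emax (d t s) (weight M V s)) <= V s) ->
  (expected_total_reward M psi P noise state <= (V s0)%:E)%E.
Proof.
move=> sub; apply: (lee_cvg_to expected_total_reward_cvg (@discounted_state_mean_cvg V (V s0))).
apply: nearW => n; under eq_bigr do rewrite stage_mean_finite.
rewrite sumEFin lee_fin; elim: n => [|n IHn].
  by rewrite big_nil expr0 mul1r state_mean_init subrr.
rewrite big_nat_recr //=.
have := stage_mean_le V (stage_integrable n) (dint n).
rewrite stage_mean_finite -EFinD lee_fin => step.
have le_mean : gamma ^+ n * state_mean n (fun s => fine (emax (d n s) (weight M V s)))
    <= gamma ^+ n * state_mean n V.
  by rewrite ler_wpM2l ?exprn_ge0 ?discount_ge0 // le_state_mean.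
lra.
Qed.

Lemma expected_total_reward_ge V :
  (forall t s, argmax_rule (weight M V s) (psi t s)) ->
  (forall t s, V s <= fine (emax (d t s) (weight M V s))) ->
  ((V s0)%:E <= expected_total_reward M psi P noise state)%E.
Proof.
move=> greedy super.
apply: (lee_cvg_to (@discounted_state_mean_cvg V (V s0)) expected_total_reward_cvg).
apply: nearW => n; under eq_bigr do rewrite stage_mean_finite.
rewrite sumEFin lee_fin; elim: n => [|n IHn].
  by rewrite big_nil expr0 mul1r state_mean_init subrr.
rewrite big_nat_recr //=.
have [_] := stage_mean_greedy (dint n) (greedy n).
rewrite stage_mean_finite -EFinD => -[step].
have le_mean : gamma ^+ n * state_mean n V <=
    gamma ^+ n * state_mean n (fun s => fine (emax (d n s) (weight M V s))).
  by rewrite ler_wpM2l ?exprn_ge0 ?discount_ge0 // le_state_mean.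
lra.
Qed.

End ProcessLaws.
(** * A realization with stationary laws and rules *)

Section NextStateLaw.
Context (R : realType) (S A : finType) (M : mdp R S A) (s0 : S) (a0 : A).
Local Notation noise_vec := (#|A|.-tuple R).

(** The coordinates of the streams are noise vectors; a random state is stored in
    one of them as a constant vector. *)
Definition encode_state (y : S) : noise_vec := [tuple (enum_rank y)%:R | _ < #|A|].

Definition decode_state (e : noise_vec) : S :=
  odflt s0 [pick y : S | noise_at e a0 == (enum_rank y)%:R].

Lemma encode_stateK : cancel encode_state decode_state.
Proof.
move=> y; rewrite /decode_state; case: pickP => [z|/(_ y)] /=; rewrite /noise_at tnth_mktuple.
  by rewrite eqr_nat => /eqP /ord_inj /enum_rank_inj.
by rewrite eqxx.
Qed.

Lemma measurable_decode_state (B : set S) : measurable (decode_state @^-1` B).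
Proof.
apply: measurable_fin_preimage => y.
pose pick_state (v : {ffun S -> bool}) := odflt s0 [pick y | v y].
pose b (y : S) (e : noise_vec) := noise_at e a0 == (enum_rank y)%:R.
rewrite (_ : _ @^-1` _ = [set e | pick_state [ffun y => b y e] = y]).
  apply: (@measurable_bool_family _ _ _ b [set v | pick_state v = y]) => z.
  rewrite (_ : [set t | _] = (fun e => noise_at e a0) @^-1` [set (enum_rank z)%:R]).
    by rewrite -[_ @^-1` _]setTI; exact: measurable_noise_at.
  by apply/seteqP; split => e /= /eqP.
have pickE e : decode_state e = pick_state [ffun y => b y e].
  by congr odflt; apply: eq_pick => z /=; rewrite ffunE.
by apply/seteqP; split => e /=; rewrite pickE.
Qed.

(** The law [q(.|s,a)] carried to noise vectors by [encode_state]. *)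
Definition next_state_law (x : S * A) : set noise_vec -> \bar R :=
  msum (fun i => mscale (NngNum (trans_ge0 M (nth s0 (enum S) i) x.1 x.2))
                        (dirac (encode_state (nth s0 (enum S) i)))) #|S|.

HB.instance Definition _ x := Measure.on (next_state_law x).

Lemma next_state_lawE x (C : set noise_vec) :
  next_state_law x C = (\sum_(y : S) trans M y x.1 x.2 * (encode_state y \in C)%:R)%:E.
Proof.
rewrite /next_state_law /msum /= -sumEFin -[RHS]big_enum /= (big_nth s0) big_mkord -cardE.
by apply: eq_bigr => i _; rewrite /mscale /= diracE EFinM.
Qed.

Lemma next_state_law_setT x : next_state_law x setT = 1%E.
Proof.
rewrite next_state_lawE; under eq_bigr do rewrite in_setT mulr1.
by rewrite trans_sum1.
Qed.

HB.instance Definition _ x :=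
  Measure_isProbability.Build _ _ _ (next_state_law x) (next_state_law_setT x).

Lemma next_state_law_decode x y :
  next_state_law x (decode_state @^-1` [set y]) = (trans M y x.1 x.2)%:E.
Proof.
rewrite next_state_lawE (bigD1 y) //= big1 ?addr0 => [|z zy].
  by rewrite mem_set ?mulr1 //= encode_stateK.
by rewrite memNset ?mulr0 //= encode_stateK => /eqP; rewrite (negbTE zy).
Qed.

End NextStateLaw.
Section StationaryProcess.
Context (R : realType) (S A : finType) (M : mdp R S A) (s0 : S) (a0 : A).
Local Notation noise_vec := (#|A|.-tuple R).
Context (D : S -> noise_law R A) (psi : S -> noise_vec -> A).
Hypothesis mpsi : forall s a, measurable (psi s @^-1` [set a]).

Let nS := #|S|.
Let period := (nS + #|{: S * A}|)%N.

(** A period of the stream holds one noise vector for each state, followed by one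
    candidate next state for each pair of a state and an action. In this
    order, what is known when the noise or the candidates are drawn is decided by
    earlier coordinates. *)
Definition noise_coord (t : nat) (s : S) : nat := (t * period + enum_rank s)%N.

Definition next_coord (t : nat) (x : S * A) : nat := (t * period + (nS + enum_rank x))%N.

Definition block_law (i : nat) : noise_law R A :=
  if insub i is Some k then D (enum_val (k : 'I_#|S|))
  else if insub (i - nS)%N is Some k
       then next_state_law M s0 (enum_val (k : 'I_#|{: S * A}|)) else D s0.

Definition coord_law (j : nat) : noise_law R A := block_law (j %% period).

Lemma noise_coord_law t i : (i < nS)%N -> coord_law (t * period + i) = block_law i.
Proof.
move=> iS; rewrite /coord_law modnMDl modn_small //.
exact: leq_trans iS (leq_addr _ _).
Qed.

Lemma block_law_noise (k : 'I_nS) : block_law k = D (enum_val k).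
Proof. by rewrite /block_law valK. Qed.

Lemma next_coord_law t x : coord_law (next_coord t x) = next_state_law M s0 x.
Proof.
rewrite /coord_law /next_coord modnMDl modn_small; last by rewrite ltn_add2l.
rewrite /block_law insubF; last by rewrite ltnNge leq_addr.
by rewrite addKn valK enum_rankK.
Qed.

Local Notation Omega := (stream_space noise_vec).

Definition stream_noise (t : nat) (s : S) (o : Omega) : noise_vec := o (noise_coord t s).

Fixpoint stream_state (t : nat) (o : Omega) : S :=
  if t is t'.+1 then
    let x := stream_state t' o in
    decode_state s0 a0 (o (next_coord t' (x, psi x (stream_noise t' x o))))
  else s0.

Local Notation act := (action (fun=> psi) stream_noise stream_state).

Definition stream_state_action t (o : Omega) : S * A := (stream_state t o, act t o).

Let before n := g_sigma_algebraType (@coordinate_sets _ noise_vec n).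

Lemma noise_before t s n (B : set noise_vec) : (noise_coord t s < n)%N -> measurable B ->
  cylinder_before n (stream_noise t s @^-1` B).
Proof. exact: cylinder_before_coord. Qed.

Lemma noise_coord_lt t s : (noise_coord t s < t * period + nS)%N.
Proof. by rewrite ltn_add2l. Qed.

Lemma state_action_beforeP t :
  (forall x, cylinder_before (t * period) (stream_state t @^-1` [set x])) ->
  forall x, cylinder_before (t * period + nS) (stream_state_action t @^-1` [set x]).
Proof.
move=> st [s a].
rewrite (_ : _ @^-1` _ = stream_state t @^-1` [set s] `&`
    stream_noise t s @^-1` (psi s @^-1` [set a])); last first.
  apply/seteqP; split => w; first by move=> [/= <- <-].
  by move=> [/= sE aE]; rewrite /stream_state_action /action sE aE.
apply: (@measurableI _ (before _)).
  exact: cylinder_beforeW (leq_addr _ _) _ (st s).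
by apply: noise_before; [exact: noise_coord_lt|exact: mpsi].
Qed.

Lemma state_before t x : cylinder_before (t * period) (stream_state t @^-1` [set x]).
Proof.
elim: t x => [|t IHt] x.
  have [<-|s0x] := eqVneq s0 x.
    rewrite (_ : _ @^-1` _ = setT); first exact: cylinder_beforeT.
    by apply/seteqP; split.
  rewrite (_ : _ @^-1` _ = set0); first exact: (@measurable0 _ (before _)).
  by apply/seteqP; split => // w /= /eqP; rewrite (negbTE s0x).
rewrite (_ : _ @^-1` _ = \bigcup_(y in [set: S * A]) (stream_state_action t @^-1` [set y] `&`
    (fun o : nat -> noise_vec => o (next_coord t y)) @^-1`
      (decode_state s0 a0 @^-1` [set x]))); last first.
  apply/seteqP; split => [w h|w [y _ [/= <- //]]].
  by exists (stream_state_action t w).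
apply: (@fin_bigcup_measurable _ (before _)) => [|y _]; first exact: finite_finset.
apply: (@measurableI _ (before _)).
  apply: cylinder_beforeW (state_action_beforeP IHt y).
  by rewrite mulSn [X in (_ <= X)%N]addnC leq_add2l leq_addr.
apply: cylinder_before_coord; last exact: measurable_decode_state.
by rewrite mulSn [X in (_ < X)%N]addnC !ltn_add2l.
Qed.

Lemma state_action_before t x :
  cylinder_before (t * period + nS) (stream_state_action t @^-1` [set x]).
Proof. by apply: state_action_beforeP; exact: state_before. Qed.

(** Noise and states up to a given time are functions of the coordinates read so
    far. *)
Lemma history_before m n k (H : set Omega) : (m <= n)%N ->
  (n.-1 * period <= k)%N -> (forall t s, (t < m)%N -> (noise_coord t s < k)%N) ->
  history stream_noise stream_state m n H -> cylinder_before k H.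
Proof.
move=> mn nk mk.
apply: (@preimage_generated_measurable _ (before k) _ _ id) => X.
move=> [[t [s [B [tm mB ->]]]]|[t [x [tn ->]]]].
  by apply: noise_before => //; exact: mk.
have tk : (t * period <= k)%N.
  by apply: leq_trans nk; rewrite leq_mul2r; apply/orP; right; case: n tn {mn}.
exact: (cylinder_beforeW tk (@state_before t x)).
Qed.

Let P := stream_law coord_law 0.

(** Both conditional laws are instances of [stream_law_indep]: the events of the
    history are decided by earlier coordinates than those that carry the noise,
    respectively the candidates for the next state. *)
Lemma stationary_process : ds_process M (fun=> D) (fun=> psi) P stream_noise stream_state s0.
Proof.
split.
- by move=> t s; exact: measurable_coord.
- by move=> t x; exact: measurable_cylinder_before (@state_before t x).
- by [].
- move=> n H B hist mB.
  have nH : cylinder_before (n * period) H.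
    apply: history_before hist => // t s tn.
    apply: leq_trans (noise_coord_lt t s) _.
    apply: (@leq_trans (t.+1 * period)); last by rewrite leq_mul2r tn orbT.
    by rewrite mulSn [X in (_ <= X)%N]addnC leq_add2l leq_addr.
  pose B' (i : nat) := if insub i is Some k then B (enum_val (k : 'I_nS)) else setT.
  have mB' i : measurable (B' i) by rewrite /B'; case: insubP.
  rewrite (_ : [set o | _] = shift_stream (n * period) @^-1`
      [set x | forall i, (i < nS)%N -> B' i (x i)]); last first.
    apply/seteqP; split => w /= h.
      move=> i iS; rewrite /B' insubT /= /shift_stream.
      have := h (enum_val (Ordinal iS)).
      by rewrite /stream_noise /noise_coord enum_valK.
    move=> s; have := h (enum_rank s) (ltn_ord _).
    by rewrite /B' valK enum_rankK.
  have box : cylinder [set x : nat -> noise_vec | forall i, (i < nS)%N -> B' i (x i)].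
    by exists nS; exact: cylinder_before_box.
  apply: etrans (@stream_law_indep _ _ R coord_law (n * period) 0 H _ nH box) _.
  congr (_ * _)%E; rewrite stream_law_box // (reindex (@enum_val S predT)) /=; last first.
    exact/onW_bij/enum_val_bij.
  apply: eq_bigr => i _; rewrite add0n noise_coord_law // block_law_noise.
  by rewrite /B' valK.
- move=> n H x a y hist.
  have nH : cylinder_before (n * period + nS) H.
    apply: history_before hist => //; first exact: leq_addr.
    move=> t s tn; apply: leq_trans (noise_coord_lt t s) _.
    by rewrite leq_add2r leq_mul2r (_ : (t <= n)%N) ?orbT.
  pose H' := H `&` stream_state_action n @^-1` [set (x, a)].
  have nH' : cylinder_before (n * period + nS) H'.
    by apply: (@measurableI _ (before _)) => //; exact: state_action_before.
  have H'E : H `&` [set o | stream_state n o = x /\ act n o = a] = H'.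
    congr (_ `&` _); apply/seteqP; split => w; first by move=> [sE aE]; rewrite /= -sE -aE.
    by move=> [].
  have mB := @measurable_decode_state R S A s0 a0 [set y].
  pose G := [set z : nat -> noise_vec | (decode_state s0 a0 @^-1` [set y]) (z (enum_rank (x, a)))].
  have GE w : stream_state_action n w = (x, a) ->
      G (shift_stream (n * period + nS) w) <-> stream_state n.+1 w = y.
    move=> wE; rewrite -[stream_state n.+1 w]/(decode_state s0 a0 (w (next_coord n (stream_state_action n w)))) wE.
    by rewrite /G /= /shift_stream -addnA.
  rewrite H'E (_ : _ `&` _ = H' `&` shift_stream (n * period + nS) @^-1` G); last first.
    rewrite -setIA; congr (_ `&` _); apply/seteqP; split => w.
      move=> [sE aE yE]; have wE : stream_state_action n w = (x, a) by rewrite -sE -aE.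
      by split=> //; exact/(GE w wE).
    move=> [wE /(GE w wE) yE].
    by move: wE; rewrite /= /stream_state_action => -[sE aE].
  have coord : cylinder G.
    by exists (enum_rank (x, a)).+1; exact: cylinder_before_coord.
  apply: etrans (@stream_law_indep _ _ R coord_law (n * period + nS) 0 H' _ nH' coord) _.
  rewrite stream_law_coord // add0n muleC; congr (_ * _)%E.
  by rewrite -addnA next_coord_law; exact: next_state_law_decode.
Qed.

End StationaryProcess.
(** * The value function *)

Section ValueFunction.
Context (R : realType) (S A : finType) (M : mdp R S A).
Context (Xi : S -> set (noise_law R A)).
Hypothesis A0 : (0 < #|A|)%N.
Hypothesis Xi0 : forall s, Xi s !=set0.
Hypothesis Xi_int : forall s d, Xi s d -> noise_integrable d.
Hypothesis gamma1 : discount M < 1.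
Local Notation gamma := (discount M).
Local Notation noise_vec := (#|A|.-tuple R).
Context (V : S -> R).
Hypothesis TV : forall s, bellman M Xi V s = (V s)%:E.

(** A fixed point bounds the mean maximum under every admissible law. *)
Lemma ds_value_le s0 : (ds_value M Xi s0 <= (V s0)%:E)%E.
Proof.
apply: ge_ereal_sup => _ [d [psi [Xd mpsi [dO [W [P [noise [state [proc total_int ->]]]]]]]]].
have dint t s : noise_integrable (d t s) := Xi_int (Xd t s).
apply: (expected_total_reward_le A0 mpsi proc gamma1 dint total_int) => t s.
rewrite -lee_fin -TV bellmanE fineK ?emax_fin //; exact: emax_le_phi.
Qed.

Lemma weight_shift c s : weight M (fun s => V s + c) s = (fun a => weight M V s a + gamma * c).
Proof. by apply/funext => a; exact: weightD. Qed.

(** Laws that are optimal up to [e * (1 - gamma)] make [V - e] a subsolution of the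
    Bellman equation, because lowering [V] by [e] lowers the weights by
    [gamma * e] only. The argmax rules of [V] and [V - e] are the same. *)
Lemma ds_value_ge s0 : ((V s0)%:E <= ds_value M Xi s0)%E.
Proof.
apply/lee_addgt0Pr => e e0.
have g1 : 0 < 1 - gamma by rewrite subr_gt0.
have [a0 _] := card_gt0P A0.
have phiV s : phi Xi s (weight M V s) = (V s)%:E by rewrite -bellmanE.
have /choice[D DP] : forall s, exists d, Xi s d /\
    V s - e * (1 - gamma) <= fine (emax d (weight M V s)).
  move=> s; have phi_w : (phi Xi s (weight M V s) < +oo)%E by rewrite phiV ltry.
  have [d Xd] := near_maximizer A0 Xi0 Xi_int phi_w (weight M V s) (mulr_gt0 e0 g1).
  by rewrite phiV => dV; exists d.
have Dint s : noise_integrable (D s) := Xi_int (DP s).1.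
have /choice[psi psiP] : forall s, exists psi, argmax_rule (R:=R) (weight M V s) psi.
  by move=> s; exact: argmax_rule_exists.
have mpsi s a : measurable (psi s @^-1` [set a]) by have [] := psiP s.
pose V' s := V s - e.
have greedy (_ : nat) s : argmax_rule (weight M V' s) (psi s).
  rewrite /V' weight_shift; split=> [a|w b]; first exact: mpsi.
  by have [_ /(_ w b)] := psiP s; lra.
have super (_ : nat) s : V' s <= fine (emax (D s) (weight M V' s)).
  rewrite /V' weight_shift emaxD // fineD ?emax_fin //=.
  by have [_] := DP s; lra.
have proc := stationary_process M s0 a0 D mpsi.
set P : probability _ _ := stream_law _ 0 in proc.
have [K bound] : exists K : R, forall s,
    (\int[D s]_(e in [set: noise_vec]) (`|noisy_max (weight M V' s) e| +
       \sum_x `|continuation M V' x|)%:E <= K%:E)%E.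
  set C := \sum_x _.
  pose I s := (\int[D s]_(e in [set: noise_vec]) (`|noisy_max (weight M V' s) e| + C)%:E)%E.
  have I_fin s : I s \is a fin_num.
    apply: integrable_fin_num => //.
    apply: (@integrableD _ _ _ (D s) _ measurableT
      (fun e => `|(noisy_max (weight M V' s) e)%:E|%E) (EFin \o cst C)).
      exact/integrable_abse/integrable_noisy_max.
    exact: finite_measure_integrable_cst.
  have I_ge0 s : (0 <= I s)%E.
    by apply: integral_ge0 => e' _; rewrite lee_fin addr_ge0 // sumr_ge0.
  exists (\sum_s fine (I s)) => s; rewrite -/(I s) -(fineK (I_fin s)) lee_fin.
  by rewrite (bigD1 s) //= lerDl sumr_ge0 // => s' _; exact: fine_ge0.
have total_int : total_reward_integrable M (fun=> psi) P (@stream_noise R S A)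
    (stream_state s0 a0 psi).
  exact: (greedy_total_reward_integrable A0 (fun=> mpsi) proc gamma1 (fun=> Dint) greedy
    (fun=> bound)).
have ge := expected_total_reward_ge A0 (fun=> mpsi) proc gamma1 (fun=> Dint) total_int
  greedy super.
rewrite -leeBlDr //; apply: le_trans ge _; apply: ereal_sup_ubound.
exists (fun=> D), (fun=> psi); split => //; first by move=> t s; exact: (DP s).1.
by do 2 eexists; exists P, (@stream_noise R S A), (stream_state s0 a0 psi); split.
Qed.

Lemma ds_value_fixpoint s : ds_value M Xi s = (V s)%:E.
Proof. by apply/eqP; rewrite eq_le ds_value_le ds_value_ge. Qed.

End ValueFunction.
Theorem theorem1 (R : realType) (S A : finType) (M : mdp R S A)
    (Xi : S -> set (noise_law R A))
    (A_nonempty : (0 < #|A|)%N)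
    (Xi_nonempty : forall s, Xi s !=set0)
    (Xi_continuous : forall s d, Xi s d -> continuous_law d)
    (Xi_integrable : forall s d, Xi s d ->
       d.-integrable [set: #|A|.-tuple R] (fun e => max_over (noise_at e))) :
  [/\ (* (i) *)
      (forall V V' : S -> R, (forall s, V' s <= V s) ->
         forall s, (bellman M Xi V' s <= bellman M Xi V s)%E) /\
      (forall (V : S -> R) (alpha : R) (s : S),
         bellman M Xi (fun s' => V s' + alpha) s
         = (bellman M Xi V s + (discount M * alpha)%:E)%E),
      (* (ii) *)
      forall V V' : S -> R,
        sup_norm (fun s => fine (bellman M Xi V s) - fine (bellman M Xi V' s))
        <= discount M * sup_norm (fun s => V s - V' s),
      (* (iii) *)
      discount M < 1 ->
      (forall s, (phi Xi s (reward M ^~ s) < +oo)%E) ->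
      exists2 V : S -> R, (forall s, ds_value M Xi s = (V s)%:E) &
        forall U : S -> R, (forall s, bellman M Xi U s = (U s)%:E) <-> U = V
    & (* (iv) *)
      (forall s, (phi Xi s (reward M ^~ s) < +oo)%E) ->
      (forall s, ds_value M Xi s \is a fin_num) ->
      forall s : S,
        (forall pi : A -> R, optimal_policy Xi s (opt_weight M Xi s) pi ->
           forall a, partial_exists Xi s (opt_weight M Xi s) a ->
             pi a = partial_phi Xi s (opt_weight M Xi s) a) /\
        (forall d : noise_law R A, continuous_law d ->
           sup_well_posed Xi s (opt_weight M Xi s) d ->
           forall a, partial_exists Xi s (opt_weight M Xi s) a)].

Proof.
have Xi_int s d : Xi s d -> noise_integrable d by exact: Xi_integrable.
split.
- split=> [V V' VV s|V alpha s]; first exact: le_bellman.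
  exact: bellmanD.
- by move=> V V'; exact: bellman_contraction.
- move=> gamma1 phi_bounded.
  have [V TV] := bellman_fixpoint A_nonempty Xi_nonempty Xi_int phi_bounded gamma1.
  exists V => [s|U]; first exact: ds_value_fixpoint.
  split=> [TU|->]; last exact: TV.
  exact: bellman_unique TU TV.
- move=> phi_bounded _ s.
  have phi_w : (phi Xi s (opt_weight M Xi s) < +oo)%E.
    by have := phi_fin A_nonempty Xi_nonempty Xi_int (opt_weight M Xi s) (phi_bounded s);
      rewrite fin_numElt => /andP[].
  split=> [pi pi_opt a|d dc dwp a]; first exact: derive_optimal_policy.
  exact: well_posed_partial_exists dwp.
Qed.
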